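(* (First part.) For $i=1,2$ let $(\mathfrak R_i,V_i)$ be a LEARS, $V_i'$ a reflectable subspace of $V_i$, $\Delta_i=\Delta_{V_i'}$, and $(S_i,L_i,E_i)$ the associated triple. Suppose $\varphi:V_1\to V_2$ is an isomorphism of LEARS from $(\mathfrak R_1,V_1)$ to $(\mathfrak R_2,V_2)$, i.e. a linear isomorphism with $\varphi(\mathfrak R_1)=\mathfrak R_2$. Let $\zeta$ be the composition of $\varphi|_{V_1'}$ with the projection of $V_2=V_2'\oplus V_2^0$ onto $V_2'$, and $\psi$ the composition of $\varphi|_{V_1'}$ with the projection onto $V_2^0$. Then $\zeta$ is an isomorphism of root systems $(\Delta_1,V_1')\to(\Delta_2,V_2')$ (a linear isomorphism with $\zeta(\Delta_1)=\Delta_2$), and $$\varphi(S_1)=S_2-s_2,\qquad \varphi(L_1)=L_2-l_2,\qquad \varphi(E_1)=E_2-2s_2$$ for some $s_2\in S_2$ and $l_2\in L_2$. (Second part.) Conversely, let $\zeta:(\Delta_1,V_1)\to(\Delta_2,V_2)$ be an isomorphism of locally finite irreducible root systems, let $(S_1,L_1,E_1)$ be a triple in a $\mathbb Q$-vector space $W_1$ and $(S_2,L_2,E_2)$ a triple in a $\mathbb Q$-vector space $W_2$, both admissible for the type of $\Delta_1$, and let $\varphi:W_1\to W_2$ be a linear isomorphism such that $\varphi(S_1)=S_2-s_2$, $\varphi(L_1)=L_2-l_2$ and $\varphi(E_1)=E_2-2s_2$ for some $s_2\in S_2$ and $l_2\in L_2$. Then the LEARS $(\mathfrak R(S_1,L_1,E_1),V_1\oplus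 W_1)$ is isomorphic to the LEARS $(\mathfrak R(S_2,L_2,E_2),V_2\oplus W_2)$. (Statements about $L_i,l_2$ or $E_i$ are omitted when the type has no long, respectively no extra long, roots.)
   Context: LEARS: let $V$ be a vector space over $\mathbb Q$ with a positive semidefinite symmetric bilinear form $(\cdot,\cdot)$. A nonempty subset $\mathfrak R\subset V$ is a locally extended affine root system (LEARS) if (A1) $(\alpha,\alpha)\ne0$ for all $\alpha\in\mathfrak R$ and $\mathfrak R$ spans $V$; (A2) $\langle\alpha,\beta\rangle:=\frac{2(\alpha,\beta)}{(\beta,\beta)}\in\mathbb Z$ for $\alpha,\beta\in\mathfrak R$; (A3) $\sigma_\alpha(\beta):=\beta-\langle\beta,\alpha\rangle\alpha\in\mathfrak R$ for $\alpha,\beta\in\mathfrak R$; (A4) $\mathfrak R=\mathfrak R_1\cup\mathfrak R_2$ and $(\mathfrak R_1,\mathfrak R_2)=0$ imply $\mathfrak R_1=\emptyset$ or $\mathfrak R_2=\emptyset$. $V^0$ is the radical of the form. $\langle X\rangle$ (for a single set $X$) denotes the additive subgroup generated by $X$. Two LEARS $(\mathfrak R,V)$, $(\mathfrak S,W)$ are isomorphic if there is a linear isomorphism $\varphi:V\to W$ with $\varphi(\mathfrak R)=\mathfrak S$ (same notion for locally finite irreducible root systems). A locally finite irreducible root system is a LEARS for which the form is positive definite. These are: the finite irreducible root systems $A_\ell$ ($\ell\ge1$), $B_\ell$ ($\ell\ge1$, $B_1=A_1$), $C_\ell$ ($\ell\ge2$, $C_2=B_2$), $D_\ell$ ($\ell\ge4$),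 $E_6,E_7,E_8,F_4,G_2$, $BC_\ell$ ($\ell\ge1$), and for infinite $\mathfrak I$, with $\{\epsilon_i\}_{i\in\mathfrak I}$ orthonormal, $A_{\mathfrak I}=\{\epsilon_i-\epsilon_j\mid i\ne j\}$, $B_{\mathfrak I}=\{\pm\epsilon_i,\pm(\epsilon_i\pm\epsilon_j)\mid i\neq j\}$, $C_{\mathfrak I}=\{\pm(\epsilon_i\pm\epsilon_j),\pm2\epsilon_i\mid i\ne j\}$, $D_{\mathfrak I}=\{\pm(\epsilon_i\pm\epsilon_j)\mid i\ne j\}$, $BC_{\mathfrak I}=B_{\mathfrak I}\cup C_{\mathfrak I}$. $X_{\mathfrak I}$ for finite $\mathfrak I$ means the finite system $X_\ell$ of rank $\ell=|\mathfrak I|$. $\Delta_{sh}$: roots of minimal length (short); $\Delta_{ex}$: roots that are twice a short root (extra long); $\Delta_{lg}$: all other roots (long). Let $\bar{\ }:V\to V/V^0$ be the projection; $\bar{\mathfrak R}$ is a locally finite irreducible root system. Put $\bar{\mathfrak R}^{\mathrm{red}}=\bar{\mathfrak R}$ if $2\alpha\notin\bar{\mathfrak R}$ for all $\alpha\in\bar{\mathfrak R}$, and $\{\alpha\in\bar{\mathfrak R}\mid\frac12\alpha\notin\bar{\mathfrak R}\}$ otherwise. A reflectable base of a reduced locally finite irreducible root system $\Phi$ is a vector space basis $\Pi\subset\Phi$ of its span such that every $\alpha\in\Phi$ has the form $\sigma_{\alpha_1}\cdots\sigma_{\alpha_k}(\alpha_{k+1})$ with all $\alpha_i\in\Pi$.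 Choose a reflectable base $\Pi$ of $\bar{\mathfrak R}^{\mathrm{red}}$ and a preimage $\alpha\in\mathfrak R$ of each $\bar\alpha\in\Pi$; the span $V'$ of these preimages is a reflectable subspace, and $V=V'\oplus V^0$. Put $\Delta_{V'}=\{\alpha\in V'\mid \alpha+s\in\mathfrak R\text{ for some }s\in V^0\}$, a locally finite irreducible root system in $V'$. It is known that there are subsets $S,L,E\subset V^0$ (the triple associated with $V'$) with $\{s\in V^0\mid\alpha+s\in\mathfrak R\}=S$, $L$, $E$ for $\alpha$ short, long, extra long in $\Delta_{V'}$ respectively. A subset $E$ of an abelian group is a reflection space if $E-2E\subset E$ (set of all $x-2y$), and pointed if $0\in E$. A triple $(S,L,E)$ of nonempty subsets of a $\mathbb Q$-vector space $W$ ($L$ present only if $\Delta_{lg}\ne\emptyset$, $E$ only if $\Delta_{ex}\neq\emptyset$), with $S$ spanning $W$, $G:=\langle S\rangle$, $E\subset L\subset S$ (for those present), is admissible for the type of $\Delta$ if: $S$ and $L$ are pointed reflection spaces, $E$ is a reflection space, and - $A_{\mathfrak I}$: if not $A_1$, then $S=G$; - $B_{\mathfrak I}$ ($|\mathfrak I|\ge2$): $2S+L\subset L$, $S+L\subset S$, and $L$ is a subgroup if $|\mathfrak I|>2$; - $C_{\mathfrak I}$: $2S+L\subset L$, $S+L\subset S$, and $S=G$ if $|\mathfrak I|>2$; - $D_{\mathfrak I},E_6,E_7,E_8$: $S=G$; - $BC_{\mathfrak I}$, $|\mathfrak I|\ge2$: $2S+L\subset L$, $S+L\subset S$, $4S+E\subset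 E$, $S+E\subset S$, $2L+E\subset E$, $L+E\subset L$, and $L$ is a subgroup if $|\mathfrak I|>2$; - $BC_1$: $4S+E\subset E$, $S+E\subset S$; - $F_4$: $S=G$, $L$ a subgroup with $2G\subset L$; - $G_2$: $S=G$, $L$ a subgroup with $3G\subset L$. For a locally finite irreducible root system $\Delta$ in $V_i$ and an admissible triple in $W_i$, $\mathfrak R(S,L,E)=(\Delta_{sh}+S)\sqcup(\Delta_{lg}+L)\sqcup(\Delta_{ex}+E)\subset V_i\oplus W_i$, where the positive definite form of $V_i$ is extended to $V_i\oplus W_i$ with radical $W_i$; this is a LEARS. In the second part $\mathfrak R(S_i,L_i,E_i)$ is formed with $\Delta=\Delta_i$. *)

(* Defs.v *)
From HB Require Import structures.
From mathcomp Require Import all_boot all_order all_algebra.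
From mathcomp Require Import ring_quotient generic_quotient sesquilinear.
From mathcomp Require Import boolp classical_sets functions cardinality.

Set Implicit Arguments.
Unset Strict Implicit.
Unset Printing Implicit Defensive.

Import Order.TTheory GRing.Theory Num.Theory.
Import Quotient.Exports.

Local Open Scope classical_set_scope.
Local Open Scope ring_scope.

Section LinearAlgebra.
Variable V : lmodType rat.
Implicit Types (A B P : set V) (v : V).

Definition is_subgroup (U : zmodType) (H : set U) : Prop :=
  H 0 /\ forall x y, H x -> H y -> H (x - y).

Definition subgroup_gen (U : zmodType) (A : set U) : set U :=
  smallest (@is_subgroup U) A.

Definition is_subspace A : Prop :=
  A 0 /\ forall (c : rat) x y, A x -> A y -> A (c *: x + y).

Definition lspan A : set V := smallest is_subspace A.

Definition lin_indep P : Prop :=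
  forall (s : seq V) (c : V -> rat), uniq s -> (forall v, v \in s -> P v) ->
    \sum_(v <- s) c v *: v = 0 -> forall v, v \in s -> c v = 0.

(* The projection onto A along B; it is meaningful when V is the direct sum of
   the subspaces A and B, in which case the component chosen by xget is
   unique. *)
Definition proj_along A B v : V := xget 0 [set a | A a /\ B (v - a)].

End LinearAlgebra.

(* Isomorphisms (R, A) -> (S, B), where R and S are subsets of subspaces A and B
   of the ambient spaces; only the restriction of phi to A matters. *)
Definition root_iso (V W : lmodType rat) (A R : set V) (B S : set W)
    (phi : V -> W) : Prop :=
  [/\ forall (c : rat) x y, A x -> A y -> phi (c *: x + y) = c *: phi x + phi y,
      set_bij A B phi
    & phi @` R = S].

Section Forms.
Variables (V : lmodType rat) (f : V -> V -> rat).
Implicit Types (R D Phi P : set V).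

Definition pairing (a b : V) : rat := 2 * f a b / f b b.

Definition reflection (a b : V) : V := b - pairing b a *: a.

Definition short_roots D : set V :=
  [set a | D a /\ forall b, D b -> f a a <= f b b].

Definition extra_long_roots D : set V :=
  [set a | D a /\ exists2 b, short_roots D b & a = 2 *: b].

Definition long_roots D : set V :=
  D `\` (short_roots D `|` extra_long_roots D).

Definition reflectable_base Phi P : Prop :=
  [/\ P `<=` Phi, lin_indep P, lspan P = lspan Phi
    & forall a, Phi a ->
        exists (s : seq V) (b : V),
          [/\ forall c, c \in s -> P c, P b & a = foldr reflection b s]].

End Forms.

Definition reduced_part (V : lmodType rat) (R : set V) : set V :=
  if `[< forall a, R a -> ~ R (2 *: a) >] then R
  else [set a | R a /\ ~ R (2^-1 *: a)].

Definition is_LEARS (V : lmodType rat) (f : {symmetric V}) (R : set V) : Prop :=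
  [/\ [/\ (forall v, 0 <= f v v) & R !=set0],
      (forall a, R a -> f a a != 0) /\ lspan R = setT,
      forall a b, R a -> R b -> pairing f a b \is a Num.int,
      forall a b, R a -> R b -> R (reflection f a b)
    & forall R1 R2, R = R1 `|` R2 ->
        (forall a b, R1 a -> R2 b -> f a b = 0) -> R1 = set0 \/ R2 = set0].

Definition is_LFIRS (V : lmodType rat) (f : {symmetric V}) (D : set V) : Prop :=
  is_LEARS f D /\ forall v, v != 0 -> 0 < f v v.

Section RadicalQuotient.
Variables (V : lmodType rat) (f : {symmetric V}).

Definition radical : set V := [set v | forall w, f v w = 0].

Definition radical_pred : V -> bool := fun v => `[< radical v >].

Lemma radical_submod_closed : submod_closed (radical_pred : {pred V}).
Proof.
split=> [|c x y /asboolP hx /asboolP hy]; apply/asboolP => w.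
  by rewrite linear0l.
by rewrite linearPl /= hx hy mulr0 addr0.
Qed.

HB.instance Definition _ :=
  GRing.isSubmodClosed.Build rat V radical_pred radical_submod_closed.

Definition radical_zmod : zmodClosed V :=
  GRing.ZmodClosed.clone V radical_pred _.

Definition modrad : Type := Quotient.quot radical_zmod.

HB.instance Definition _ := GRing.Zmodule.on modrad.

Definition to_modrad (v : V) : modrad := \pi_(Quotient.quot radical_zmod)%qT v.

(* A chosen representative in V of a class modulo the radical. *)
Definition of_modrad (x : modrad) : V :=
  @repr _ (Quotient.quot radical_zmod) x.

Lemma of_modradK : cancel of_modrad to_modrad.
Proof. exact: reprK. Qed.

Lemma to_modrad_eq u v : to_modrad u = to_modrad v <-> radical (u - v).
Proof.
rewrite /to_modrad; split => [/eqP|h].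
  by rewrite -Quotient.idealrBE => /asboolP.
by apply/eqP; rewrite -Quotient.idealrBE; apply/asboolP.
Qed.

Lemma to_modradB : zmod_morphism to_modrad.
Proof. by move=> x y; rewrite /to_modrad raddfB. Qed.

HB.instance Definition _ :=
  GRing.isZmodMorphism.Build V modrad to_modrad to_modradB.

Definition scale_modrad (c : rat) (x : modrad) : modrad :=
  to_modrad (c *: of_modrad x).

Lemma scale_to_modrad c v : scale_modrad c (to_modrad v) = to_modrad (c *: v).
Proof.
apply/to_modrad_eq; rewrite -scalerBr => w; rewrite linearZl_LR /=.
have /to_modrad_eq -> : to_modrad (of_modrad (to_modrad v)) = to_modrad v.
  by rewrite of_modradK.
by rewrite mulr0.
Qed.

Lemma scale_modradA c d x :
  scale_modrad c (scale_modrad d x) = scale_modrad (c * d) x.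
Proof. by rewrite -[x]of_modradK !scale_to_modrad scalerA. Qed.

Lemma scale_modrad1 : left_id 1 scale_modrad.
Proof. by move=> x; rewrite -[x]of_modradK scale_to_modrad scale1r. Qed.

Lemma scale_modradDr : right_distributive scale_modrad +%R.
Proof.
move=> c x y; rewrite -[x]of_modradK -[y]of_modradK -raddfD.
by rewrite !scale_to_modrad scalerDr raddfD.
Qed.

Lemma scale_modradDl x : {morph scale_modrad^~ x : c d / c + d}.
Proof.
by move=> c d; rewrite -[x]of_modradK !scale_to_modrad scalerDl raddfD.
Qed.

HB.instance Definition _ := GRing.Zmodule_isLmodule.Build rat modrad
  scale_modradA scale_modrad1 scale_modradDr scale_modradDl.

(* The form induced by f on the quotient; see modrad_formE. *)
Definition modrad_form (x y : modrad) : rat := f (of_modrad x) (of_modrad y).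

Lemma modrad_formE u v : modrad_form (to_modrad u) (to_modrad v) = f u v.
Proof.
have E z w : f (of_modrad (to_modrad z)) w = f z w.
  have /to_modrad_eq/(_ w) : to_modrad (of_modrad (to_modrad z)) = to_modrad z.
    by rewrite of_modradK.
  by rewrite linearBl => /eqP; rewrite subr_eq0 => /eqP.
by rewrite /modrad_form E hermC E [RHS]hermC.
Qed.

End RadicalQuotient.

(* V' is the span of one preimage in R of each element of a reflectable base of
   the reduced part of the image of R in V modulo the radical. *)
Definition reflectable_subspace (V : lmodType rat) (f : {symmetric V})
    (R V' : set V) : Prop :=
  exists (P : set (modrad f)) (p : modrad f -> V),
    [/\ reflectable_base (@modrad_form V f)
          (reduced_part (@to_modrad V f @` R)) P,
        forall x, P x -> R (p x) /\ to_modrad f (p x) = x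
      & V' = lspan (p @` P)].

Definition Delta_of (V : lmodType rat) (f : {symmetric V}) (R V' : set V) :
    set V :=
  [set a | V' a /\ exists2 s, radical f s & R (a + s)].

(* L (resp. E) is unconstrained when there are no long (resp. extra long)
   roots. *)
Definition associated_triple (V : lmodType rat) (f : {symmetric V})
    (R V' S L E : set V) : Prop :=
  let D := Delta_of f R V' in
  let shifts a := [set s | radical f s /\ R (a + s)] in
  [/\ S `<=` radical f /\ forall a, short_roots f D a -> shifts a = S,
      long_roots f D !=set0 ->
        L `<=` radical f /\ forall a, long_roots f D a -> shifts a = L
    & extra_long_roots f D !=set0 ->
        E `<=` radical f /\ forall a, extra_long_roots f D a -> shifts a = E].

Section ReflectionSpaces.
Variable W : lmodType rat.
Implicit Types A B : set W.

Definition set_add A B : set W := [set a + b | a in A & b in B].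
Definition set_scale (c : rat) A : set W := [set c *: a | a in A].
Definition set_shift A (x : W) : set W := [set a - x | a in A].

Definition reflection_space A : Prop := set_add A (set_scale (- 2) A) `<=` A.
Definition pointed A : Prop := A 0.

End ReflectionSpaces.

(* hasL and hasE say whether long and extra long roots exist. *)
Definition triples_related (hasL hasE : Prop) (W1 W2 : lmodType rat)
    (phi : W1 -> W2) (S1 L1 E1 : set W1) (S2 L2 E2 : set W2) : Prop :=
  (exists2 s2, S2 s2 & phi @` S1 = set_shift S2 s2 /\
     (hasE -> phi @` E1 = set_shift E2 (2 *: s2))) /\
  (hasL -> exists2 l2, L2 l2 & phi @` L1 = set_shift L2 l2).

(* TypeAfin l is A_l, with l + 1 coordinates, whereas TypeA I is A_I for
   infinite I.  In the other families I is finite or infinite, X_I being X_l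
   when I has l elements. *)
Inductive root_type : Type :=
  | TypeAfin of nat
  | TypeA of eqType
  | TypeB of eqType
  | TypeC of eqType
  | TypeD of eqType
  | TypeBC of eqType
  | TypeE6 | TypeE7 | TypeE8 | TypeF4 | TypeG2.

Definition card_atleast (n : nat) (I : Type) : Prop := (`I_n #<= [set: I])%card.

(* The standard models live in the space of all functions I -> rat, but they
   consist of finitely supported functions and only their span is used. *)
Section Models.
Variable I : eqType.

Definition eps (i : I) : I -> rat^o := fun j => (i == j)%:R.

Definition A_model : set (I -> rat^o) :=
  [set x | exists i j, i != j /\ x = eps i - eps j].

Definition D_model : set (I -> rat^o) :=
  [set x | exists (i j : I) (b c : bool),
     i != j /\ x = (-1) ^+ b *: (eps i + (-1) ^+ c *: eps j)].

Definition B_model : set (I -> rat^o) :=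
  [set x | exists (i : I) (b : bool), x = (-1) ^+ b *: eps i] `|` D_model.

Definition C_model : set (I -> rat^o) :=
  D_model `|` [set x | exists (i : I) (b : bool), x = (-1) ^+ b *: (2 *: eps i)].

Definition BC_model : set (I -> rat^o) := B_model `|` C_model.

End Models.

Arguments A_model : clear implicits.
Arguments B_model : clear implicits.
Arguments C_model : clear implicits.
Arguments D_model : clear implicits.
Arguments BC_model : clear implicits.

(* Half of a vector of signs, with the minus signs at the positions in s. *)
Definition half_signs (n : nat) (s : {set 'I_n}) : 'I_n -> rat^o :=
  fun i => (-1) ^+ (i \in s) / 2.

Definition E8_model : set ('I_8 -> rat^o) :=
  D_model 'I_8 `|` [set x | exists s : {set 'I_8}, ~~ odd #|s| /\ x = half_signs s].

(* E7 and E6 are cut out of E8 by orthogonality to eps_7 + eps_8, and to both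
   eps_7 + eps_8 and eps_6 - eps_7 (with coordinates numbered from 1). *)
Definition E7_model : set ('I_8 -> rat^o) :=
  [set x | E8_model x /\ x (inord 6) = - x (inord 7)].

Definition E6_model : set ('I_8 -> rat^o) :=
  [set x | E7_model x /\ x (inord 5) = x (inord 6)].

Definition F4_model : set ('I_4 -> rat^o) :=
  B_model 'I_4 `|` [set x | exists s : {set 'I_4}, x = half_signs s].

Definition G2_model : set ('I_3 -> rat^o) :=
  A_model 'I_3 `|`
  [set x | exists (i j k : 'I_3) (b : bool), uniq [:: i; j; k] /\
     x = (-1) ^+ b *: (2 *: eps i - eps j - eps k)].

Definition iso_to_model (V : lmodType rat) (D : set V) (I : Type)
    (M : set (I -> rat^o)) : Prop :=
  exists phi : (I -> rat^o) -> V, root_iso (lspan M) M setT D phi.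

Definition has_type (V : lmodType rat) (D : set V) (T : root_type) : Prop :=
  match T with
  | TypeAfin l => (1 <= l)%N /\ iso_to_model D (A_model 'I_l.+1)
  | TypeA J => infinite_set [set: J] /\ iso_to_model D (A_model J)
  | TypeB J => card_atleast 1 J /\ iso_to_model D (B_model J)
  | TypeC J => card_atleast 2 J /\ iso_to_model D (C_model J)
  | TypeD J => card_atleast 4 J /\ iso_to_model D (D_model J)
  | TypeBC J => card_atleast 1 J /\ iso_to_model D (BC_model J)
  | TypeE6 => iso_to_model D E6_model
  | TypeE7 => iso_to_model D E7_model
  | TypeE8 => iso_to_model D E8_model
  | TypeF4 => iso_to_model D F4_model
  | TypeG2 => iso_to_model D G2_model
  end.

Definition type_condition (W : lmodType rat) (S L E : set W) (T : root_type) :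
    Prop :=
  let G := subgroup_gen S in
  match T with
  | TypeAfin l => l <> 1%N -> S = G
  | TypeA _ => S = G
  | TypeB J => card_atleast 2 J ->
      [/\ set_add (set_scale 2 S) L `<=` L, set_add S L `<=` S
        & card_atleast 3 J -> is_subgroup L]
  | TypeC J =>
      [/\ set_add (set_scale 2 S) L `<=` L, set_add S L `<=` S
        & card_atleast 3 J -> S = G]
  | TypeD _ | TypeE6 | TypeE7 | TypeE8 => S = G
  | TypeBC J =>
      [/\ set_add (set_scale 4 S) E `<=` E, set_add S E `<=` S
        & card_atleast 2 J ->
          [/\ set_add (set_scale 2 S) L `<=` L, set_add S L `<=` S,
              set_add (set_scale 2 L) E `<=` E, set_add L E `<=` L
            & card_atleast 3 J -> is_subgroup L]]
  | TypeF4 => [/\ S = G, is_subgroup L & set_scale 2 G `<=` L]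
  | TypeG2 => [/\ S = G, is_subgroup L & set_scale 3 G `<=` L]
  end.

(* (S, L, E) is admissible for the type of D.  The same D can receive two names
   (A_1 = B_1, B_2 = C_2), for which the conditions coincide. *)
Definition admissible (V : lmodType rat) (f : V -> V -> rat) (D : set V)
    (W : lmodType rat) (S L E : set W) : Prop :=
  let hasL := long_roots f D !=set0 in
  let hasE := extra_long_roots f D !=set0 in
  [/\ [/\ S !=set0, lspan S = setT, reflection_space S & pointed S],
      hasL -> [/\ L !=set0, L `<=` S, reflection_space L & pointed L],
      hasE -> [/\ E !=set0, E `<=` S, hasL -> E `<=` L & reflection_space E]
    & exists2 T, has_type D T & type_condition S L E T].

Definition LEARS_of_triple (V : lmodType rat) (f : V -> V -> rat) (D : set V)
    (W : lmodType rat) (S L E : set W) : set (V * W) :=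
  (short_roots f D `*` S) `|` (long_roots f D `*` L)
    `|` (extra_long_roots f D `*` E).

(* Main.v *)
Require Import Defs.
From HB Require Import structures.
From mathcomp Require Import all_boot all_order all_algebra.
From mathcomp Require Import sesquilinear boolp classical_sets functions cardinality.
From mathcomp Require Import ring lra zify.

Set Implicit Arguments.
Unset Strict Implicit.
Unset Printing Implicit Defensive.

Import Order.TTheory GRing.Theory Num.Theory.

Local Open Scope classical_set_scope.
Local Open Scope ring_scope.

(** The first part rests on the fact that a LEARS determines its pairing from its
    roots alone. Pairings of roots are bounded by 4, so every root string is
    bounded and has a single centre of symmetry ([pairing_unique]); an isomorphism
    transports strings, hence pairings ([pairing_iso]), and irreducibility makes it
    multiply the form by one positive constant ([form_proportional]). It therefore
    carries radical to radical and preserves short, long and extra long roots,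
    which makes [zeta] an isomorphism of root systems ([zeta_iso]). A root [a + s]
    goes to [zeta a + (psi a + phi s)], so the fibre over [a] goes to the fibre over
    [zeta a] translated by [psi a] ([fibre_iso]). If [a] is itself a root of the
    LEARS, [psi a] lies in the target fibre; short and long roots of the reflectable
    subspace have this property, being lifts of reduced roots
    ([reduced_Delta_root]). One short root [b] gives [s2 = psi b], its double, when
    extra long, gives the shift [2 s2], and one long root gives [l2].

    In the second part the isomorphism is the shear
    [(v, w) |-> (zeta v, g v + phi w)] for a linear map [g] from [V1] to [W2] such
    that, modulo translations that stabilize [S2], [L2], [E2] respectively, [g a] is
    [s2] for [a] short, [l2] for [a] long and [2 s2] for [a] extra long
    ([adapted], [shear_iso]). Such a [g] is written down type by type
    ([adapted_exists]). It is zero for A, D, E, where only short roots exist and [S2]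
    is a group, and for F4 and G2, where [S2] and [L2] are groups. For A1 it sends the
    root to [s2]. For B, C, BC it is prescribed on the vectors [e i] corresponding to
    the coordinate vectors of the model ([adapted_BC], [adapted_C]).

    The form on the root system is not related a priori to the dot product of the
    model. For A, D, E all model vectors have norm 2, and this alone forces equal
    lengths ([simply_laced]); for B, C, BC the sign changes and exchanges of
    coordinates preserve the model and, by the uniqueness of the centre of a
    string, make the vectors [e i] orthogonal of equal length
    ([basis_orthogonal], [basis_same_length]), which identifies the length
    classes. *)

(** * Symmetric forms and root strings *)

Lemma int_factor_le4 (x y : int) : 1 <= x * y <= 4 -> `|x| <= 4.
Proof.
have [->|y0] := eqVneq y 0; first by rewrite mulr0.
case/andP=> xy1; apply: le_trans; rewrite -[leRHS]ger0_norm ?(le_trans _ xy1)//.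
by rewrite normrM ler_peMr // -gtz0_ge1 normr_gt0.
Qed.

Section Form.
Variables (V : lmodType rat) (f : {symmetric V}).

Lemma formC u v : f u v = f v u.
Proof. by rewrite hermC expr0 mul1r. Qed.

Lemma formDl u v w : f (u + v) w = f u w + f v w.
Proof. exact: linearDl. Qed.

Lemma formDr u v w : f w (u + v) = f w u + f w v.
Proof. by rewrite formC formDl ![f _ w]formC. Qed.

Lemma formZl c u w : f (c *: u) w = c * f u w.
Proof. exact: linearZl_LR. Qed.

Lemma formZr c u w : f w (c *: u) = c * f w u.
Proof. by rewrite formC formZl formC. Qed.

Lemma formNl u w : f (- u) w = - f u w.
Proof. by rewrite -scaleN1r formZl mulN1r. Qed.

Lemma formNr u w : f w (- u) = - f w u.
Proof. by rewrite formC formNl formC. Qed.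

Definition formE := (formDl, formDr, formNl, formNr, formZl, formZr).

Lemma form0l w : f 0 w = 0.
Proof. by rewrite -(scale0r 0) formZl mul0r. Qed.

Lemma form0r w : f w 0 = 0.
Proof. by rewrite formC form0l. Qed.

Lemma cauchy_schwarz (u v : V) : (forall w, 0 <= f w w) -> f v v != 0 ->
  f u v ^+ 2 <= f u u * f v v.
Proof.
move=> fge0 vn0; have vgt0 : 0 < f v v by rewrite lt_def vn0 fge0.
have := fge0 (f v v *: u - f u v *: v); rewrite !formE [f v u]formC => h.
rewrite -(ler_pM2r vgt0) -subr_ge0.
by apply: le_trans h _; rewrite le_eqVlt; apply/orP; left; apply/eqP; ring.
Qed.

Lemma pairing_mulD (a b c : V) (x : rat) :
  pairing f (b + x *: c) a = pairing f b a + x * pairing f c a.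
Proof. by rewrite /pairing !formE; ring. Qed.

Lemma pairing_self (a : V) : f a a != 0 -> pairing f a a = 2.
Proof. by move=> h; rewrite /pairing mulfK. Qed.

End Form.

Section Roots.
Variables (V : lmodType rat) (f : {symmetric V}) (R : set V).
Hypothesis HR : is_LEARS f R.

Lemma root_sq_gt0 a : R a -> 0 < f a a.
Proof.
by case: HR => [[psd _] [nz _] _ _ _] Ra; rewrite lt_def nz // psd.
Qed.

Lemma root_sq_neq0 a : R a -> f a a != 0.
Proof. by move/root_sq_gt0; rewrite lt0r => /andP[]. Qed.

Lemma root_int a b : R a -> R b -> exists n : int, pairing f a b = n%:~R.
Proof. by case: HR => _ _ h _ _ Ra Rb; apply/intrP/h. Qed.

Lemma root_reflection a b : R a -> R b -> R (b - pairing f b a *: a).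
Proof. by case: HR => _ _ _ h _ Ra Rb; apply: h. Qed.

(** Cauchy-Schwarz bounds the product of the two integers [<a,b>] and [<b,a>]
    by 4; they vanish together, so each is bounded and the product is at least 1
    unless [a] and [b] are orthogonal. *)
Lemma pairing_prod a b : R a -> R b -> f a b != 0 ->
  exists x y : int, [/\ pairing f a b = x%:~R, pairing f b a = y%:~R,
     1 <= x * y <= 4 & x%:~R * f b b = y%:~R * f a a].
Proof.
move=> Ra Rb ab0; have [x ex] := root_int Ra Rb; have [y ey] := root_int Rb Ra.
have a0 := root_sq_gt0 Ra; have b0 := root_sq_gt0 Rb.
exists x, y; split=> //; last first.
  rewrite -ex -ey /pairing [f b a]formC; field.
  by rewrite !gt_eqF.
have exy : (x * y)%:~R = 4 * (f a b ^+ 2 / (f a a * f b b)).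
  rewrite intrM -ex -ey /pairing [f b a]formC; field.
  by rewrite !gt_eqF.
have p0 : 0 < f a a * f b b by rewrite mulr_gt0.
have h1 : (0%:~R : rat) < (x * y)%:~R.
  rewrite exy mulr_gt0 // divr_gt0 // lt_def sqr_ge0 andbT.
  by rewrite expf_neq0.
have h2 : ((x * y)%:~R : rat) <= 4%:~R.
  rewrite exy -[leRHS]mulr1 ler_pM2l // ler_pdivrMr // mul1r.
  by apply: cauchy_schwarz; [case: HR => [[]] | rewrite gt_eqF].
by move: h1 h2; rewrite ltr_int ler_int => h1 ->; rewrite andbT.
Qed.

Lemma pairing_le4 a b : R a -> R b -> `|pairing f a b| <= 4.
Proof.
move=> Ra Rb; have [ab0|ab0] := eqVneq (f a b) 0.
  by rewrite /pairing ab0 mulr0 mul0r normr0.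
have [x [y [-> _ xy _]]] := pairing_prod Ra Rb ab0.
rewrite -intr_norm (_ : 4 = 4%:~R) // ler_int.
exact: int_factor_le4 xy.
Qed.

Lemma nonorthogonal_sq_le a b : R a -> R b -> f a b != 0 -> f b b <= 4 * f a a.
Proof.
move=> Ra Rb ab0; have [x [y [_ _ xy e]]] := pairing_prod Ra Rb ab0.
have a0 := root_sq_gt0 Ra; have b0 := root_sq_gt0 Rb.
have : ((x * x)%:~R * f b b = (x * y)%:~R * f a a) by rewrite !intrM -mulrA e; ring.
have x0 : x != 0 by apply: contraTneq xy => ->; rewrite mul0r.
have h1 : (1 : rat) <= (x * x)%:~R.
  rewrite (_ : 1 = 1%:~R) // ler_int -gtz0_ge1 -expr2.
  by rewrite exprn_even_gt0 //= x0.
have h2 : ((x * y)%:~R : rat) <= 4.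
  rewrite (_ : 4 = 4%:~R) // ler_int. by case/andP: xy.
move=> e2; apply: le_trans (_ : (x * x)%:~R * f b b <= _).
  by rewrite ler_peMl // ltW.
by rewrite e2 ler_pM2r.
Qed.

(** The values [<b + j d a, a> = <b,a> + 2 j d] are bounded by 4, so an infinite
    arithmetic progression of roots in the direction of a root is constant. *)
Lemma bounded_string a b d : R a -> (forall j : nat, R (b + (j%:R * d) *: a)) ->
  d = 0.
Proof.
move=> Ra h; apply/eqP/negP => /negP d0.
have bd j : `|pairing f b a + j%:R * d * 2| <= 4.
  rewrite -[2](pairing_self (root_sq_neq0 Ra)) -pairing_mulD.
  exact: pairing_le4 (h j) Ra.
pose x := 5 / `|d|; have x0 : 0 <= x by rewrite divr_ge0.
have := bd 0%N; rewrite !mul0r addr0 => h0.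
have := bd (Num.bound x); set j := Num.bound x => hj.
have xj : x < j%:R by have := archi_boundP x0.
have : `|j%:R * d * 2| <= 8.
  have -> : j%:R * d * 2 = pairing f b a + j%:R * d * 2 - pairing f b a by ring.
  by apply: le_trans (ler_normB _ _) _; lra.
have : 5 < j%:R * `|d| by rewrite -ltr_pdivrMr // normr_gt0.
by rewrite !normrM normr_nat (ger0_norm (_ : 0 <= 2 :> rat)) //; lra.
Qed.

(** The pairing can be read off from the set of roots alone: the [a]-string
    through [b] is symmetric about the reflection hyperplane of [a], and two
    distinct centres of symmetry would make it unbounded. *)
Lemma pairing_unique a b n : R a -> R b ->
  (forall k, R (b - k *: a) -> R (b - (n - k) *: a)) -> pairing f b a = n.
Proof.
move=> Ra Rb sym; apply/eqP; rewrite -subr_eq0; apply/eqP.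
apply: (bounded_string (b := b) Ra); elim => [|j IH].
  by rewrite mul0r scale0r addr0.
have := root_reflection Ra IH.
rewrite pairing_mulD (pairing_self (root_sq_neq0 Ra)).
set m := pairing f b a; set x := j%:R * (m - n) => h.
have {h}/sym : R (b - (m + x) *: a).
  suff <- : b + x *: a - (m + x * 2) *: a = b - (m + x) *: a by [].
  rewrite -addrA; congr (_ + _); rewrite -!scaleNr -scalerDl.
  by congr (_ *: _); ring.
suff -> : b - (n - (m + x)) *: a = b + (j.+1%:R * (m - n)) *: a by [].
by rewrite -scaleNr; congr (_ + _ *: _); rewrite -natr1 /x; ring.
Qed.

(** The roots not orthogonal to some root of the length of [a] are orthogonal to
    the others: if [c] meets [x] but not [y], its reflection in [x] has that length
    too, so it does not meet [y], which forces [x] and [y] to be orthogonal. *)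
Lemma connected_root a b : R a -> R b ->
  exists c, [/\ R c, f c c = f a a & f c b != 0].
Proof.
move=> Ra Rb; case: HR => _ _ _ _ irr.
pose P b := R b /\ exists c, [/\ R c, f c c = f a a & f c b != 0].
have := irr P (R `\` P); case.
- apply/seteqP; split=> [x Rx|x [[]|[]]//].
  by have [|] := pselect (P x); [left | right].
- move=> x y [Rx [c [Rc ca cx]]] [Ry nPy]; apply/eqP/negP => /negP xy.
  apply: nPy; split=> //.
  have [cy|cy] := eqVneq (f c y) 0; last by exists c.
  exists (c - pairing f c x *: x); split; first exact: root_reflection.
    rewrite /pairing !formE -ca [f x c]formC; field; exact: root_sq_neq0.
  rewrite !formE cy add0r oppr_eq0 mulf_neq0 // /pairing.
  by rewrite !mulf_neq0 // invr_eq0 root_sq_neq0.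
- move=> P0; have : P a by split=> //; exists a; split=> //; apply: root_sq_neq0.
  by rewrite P0.
- move=> Q0; suff [_ //] : P b.
  by apply: contrapT => nP; have : (R `\` P) b by []; rewrite Q0.
Qed.

(** Otherwise [P] and its complement would split [R] orthogonally. *)
Lemma irreducible_ind (P : V -> Prop) a : R a -> P a ->
  (forall x y, R x -> R y -> f x y != 0 -> P x -> P y) -> forall b, R b -> P b.
Proof.
move=> Ra Pa step b Rb; case: HR => _ _ _ _ irr.
have := irr (R `&` P) (R `\` P); case.
- apply/seteqP; split=> [x Rx|x [[]|[]]//].
  by have [|] := pselect (P x); [left | right].
- move=> x y [Rx Px] [Ry nPy]; apply/eqP/negP => /negP xy.
  by apply: nPy; apply: step xy Px.
- by move=> P0; have : (R `&` P) a by []; rewrite P0.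
- move=> Q0.
  by apply: contrapT => nP; have : (R `\` P) b by []; rewrite Q0.
Qed.

(** For non-orthogonal roots the ratio of squared lengths is a quotient of
    pairings; any other pair is brought to this case without changing lengths. *)
Lemma root_sq_le4 a b : R a -> R b -> f b b <= 4 * f a a.
Proof.
move=> Ra Rb; have [c [Rc ca cb]] := connected_root Ra Rb.
by rewrite -ca; apply: nonorthogonal_sq_le.
Qed.

(** With [x = <c,b>] and [y = <b,c>] the ratio is [y / x = y^2 / (x y)], and
    [x y], being one of 1, 2, 3, 4, divides 12. This discreteness is what makes
    shortest roots exist although [R] may be infinite. *)
Lemma root_sq_discrete a b : R a -> R b ->
  exists n : nat, 12 * f b b = n%:R * f a a.
Proof.
move=> Ra Rb; have [c [Rc ca cb]] := connected_root Ra Rb.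
have [x [y [_ _ xy e]]] := pairing_prod Rc Rb cb.
have [m hm] : exists m : int, m * (x * y) = 12.
  have : [\/ x * y = 1, x * y = 2, x * y = 3 | x * y = 4].
    have /or4P[] : [|| x * y == 1, x * y == 2, x * y == 3 | x * y == 4] by lia.
    - by move/eqP; constructor 1.
    - by move/eqP; constructor 2.
    - by move/eqP; constructor 3.
    - by move/eqP; constructor 4.
  by case=> ->; [exists 12 | exists 6 | exists 4 | exists 3].
have c0 := root_sq_gt0 Rc; have b0 := root_sq_gt0 Rb.
have E : (m * (y * y))%:~R * f c c = 12 * f b b.
  have -> : (12 : rat) = 12%:~R by [].
  by rewrite -hm !intrM -!mulrA -e; ring.
have : 0 <= m * (y * y).
  rewrite mulr_ge0 ?sqr_ge0 // -(pmulr_lge0 _ (_ : 0 < x * y)) ?hm //.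
  by case/andP: xy => /(lt_le_trans ltr01).
by rewrite -ca; case: (m * (y * y)) E => // n <- _; exists n.
Qed.

Lemma shortest_root_exists : exists2 a, R a & forall b, R b -> f a a <= f b b.
Proof.
case: (HR) => [[_ [a Ra]] _ _ _ _]; have a0 := root_sq_gt0 Ra.
pose P n := `[< exists2 b, R b & 12 * f b b = n%:R * f a a >].
have exP : exists n, P n by exists 12%N; apply/asboolP; exists a.
case: (ex_minnP exP) => n /asboolP[b Rb eb] minn; exists b => // c Rc.
have [k ek] := root_sq_discrete Ra Rc.
have kn : (n <= k)%N by apply: minn; apply/asboolP; exists c.
by rewrite -(ler_pM2l (_ : 0 < 12 :> rat)) // eb ek ler_pM2r // ler_nat.
Qed.

End Roots.

(** * Isomorphisms scale the form *)

Section Subspaces.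
Variable V : lmodType rat.

Lemma lspan_min (A B : set V) : is_subspace B -> A `<=` B -> lspan A `<=` B.
Proof. by move=> sB AB; apply: smallest_sub. Qed.

Lemma sub_lspan (A : set V) : A `<=` lspan A.
Proof. exact: sub_gen_smallest. Qed.

Lemma lspan_subspace (A : set V) : is_subspace (lspan A).
Proof.
split=> [B [[B0 _] _] //|c x y hx hy B [sB AB]].
by apply: (sB.2); [apply: hx | apply: hy].
Qed.

Lemma subspaceZ (A : set V) c x : is_subspace A -> A x -> A (c *: x).
Proof. by case=> A0 h Ax; rewrite -[_ *: _]addr0; apply: h. Qed.

Lemma subspaceD (A : set V) x y : is_subspace A -> A x -> A y -> A (x + y).
Proof. by case=> A0 h Ax Ay; rewrite -[x]scale1r; apply: h. Qed.

Lemma subspaceN (A : set V) x : is_subspace A -> A x -> A (- x).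
Proof. by move=> sA Ax; rewrite -scaleN1r; apply: subspaceZ. Qed.

Lemma subspaceB (A : set V) x y : is_subspace A -> A x -> A y -> A (x - y).
Proof. by move=> sA Ax Ay; apply: subspaceD => //; apply: subspaceN. Qed.

Lemma subspaceT : is_subspace (setT : set V).
Proof. by []. Qed.

Lemma radical_subspace (f : {symmetric V}) : is_subspace (radical f).
Proof.
split=> [w|c x y hx hy w]; first by rewrite form0l.
by rewrite !formE hx hy mulr0 addr0.
Qed.

End Subspaces.

Lemma big_uniq_sub (I : eqType) (V : zmodType) (s t : seq I) (F : I -> V) :
  uniq s -> uniq t -> {subset s <= t} ->
  (forall i, i \in t -> i \notin s -> F i = 0) ->
  \sum_(i <- s) F i = \sum_(i <- t) F i.
Proof.
move=> us ut st F0; rewrite [RHS](bigID (mem s)) /= -[LHS]addr0; congr (_ + _).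
  rewrite -[RHS]big_filter; apply: perm_big; apply: uniq_perm => //.
    exact: filter_uniq.
  by move=> i; rewrite mem_filter /= andb_idr // => /st.
by rewrite big_seq_cond big1 // => i /andP[it si]; apply: F0.
Qed.

Section RootIso.
Variables (V W : lmodType rat) (A D : set V) (B D' : set W) (z : V -> W).
Hypothesis sA : is_subspace A.
Hypothesis iso : root_iso A D B D' z.

Lemma root_iso0 : z 0 = 0.
Proof.
case: iso => lin _ _; have := lin (-1) 0 0 sA.1 sA.1.
by rewrite scaler0 addr0 scaleN1r addNr.
Qed.

Lemma root_isoZ c x : A x -> z (c *: x) = c *: z x.
Proof.
move=> Ax; case: iso => lin _ _.
by rewrite -[c *: x]addr0 lin ?root_iso0 ?addr0 //; apply: sA.1.
Qed.

Lemma root_iso_inj x y : A x -> A y -> z x = z y -> x = y.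
Proof. by case: iso => _ [_ inj _] _ Ax Ay; apply: inj; rewrite inE. Qed.

Lemma root_iso_img x : D x -> D' (z x).
Proof. by case: iso => _ _ <- Dx; exists x. Qed.

Lemma root_iso_preim x : D `<=` A -> A x -> D' (z x) -> D x.
Proof.
case: iso => _ _ <- DA Ax [y Dy e].
by rewrite -(root_iso_inj (DA _ Dy) Ax e).
Qed.

Variables (f : {symmetric V}) (g : {symmetric W}) (c : rat).
Hypotheses (DA : D `<=` A) (c0 : 0 < c).
Hypothesis sim : forall a, D a -> g (z a) (z a) = c * f a a.

(** Root systems inside subspaces are needed for [zeta] on a reflectable subspace;
    in the second part the subspaces are the whole spaces. *)
Lemma similar_short a : D a -> short_roots g D' (z a) <-> short_roots f D a.
Proof.
move=> Da; split=> [[_ h]|[_ h]]; split=> //.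
- by move=> b Db; rewrite -(ler_pM2l c0) -!sim //; apply/h/root_iso_img.
- exact: root_iso_img.
- case: (iso) => _ _ <- _ [b Db <-].
  by rewrite !sim // ler_pM2l //; apply: h.
Qed.

Lemma similar_extra a :
  D a -> extra_long_roots g D' (z a) <-> extra_long_roots f D a.
Proof.
move=> Da; split=> [[_ [b]]|[_ [b sb ab]]].
- move=> sb; have [] := sb; case: (iso) => _ _ <- [d Dd e] _ ab.
  split=> //; exists d; first by apply/similar_short; rewrite ?e.
  apply: root_iso_inj; rewrite ?root_isoZ ?e //; try exact: DA.
  by apply: subspaceZ => //; apply: DA.
- have Db := sb.1; split; first by rewrite ab; apply: root_iso_img; rewrite -ab.
  exists (z b); first exact/similar_short.
  by rewrite ab root_isoZ //; apply: DA.
Qed.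

Lemma similar_long a : D a -> long_roots g D' (z a) <-> long_roots f D a.
Proof.
move=> Da; split=> -[_ h]; (split; first by [|apply: root_iso_img]).
  by move=> [k|k]; apply: h; [left; apply/similar_short | right; apply/similar_extra].
by move=> [k|k]; apply: h; [left; apply/similar_short | right; apply/similar_extra].
Qed.

End RootIso.

Lemma pairing_solve (P p q Q : rat) : q != 0 -> Q != 0 ->
  2 * P / Q = 2 * p / q -> P = p * (Q / q).
Proof.
move=> q0 Q0 /(congr1 (fun t => t * Q / 2)).
rewrite (_ : 2 * P / Q * Q / 2 = P); last by field.
by move=> ->; field.
Qed.

Lemma ratio_transfer (P p q q' Q Q' c : rat) : p != 0 -> q != 0 -> q' != 0 ->
  Q != 0 -> Q' != 0 -> 2 * P / Q = 2 * p / q -> 2 * P / Q' = 2 * p / q' ->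
  Q = c * q -> Q' = c * q'.
Proof.
move=> p0 q0 q'0 Q0 Q'0 /pairing_solve-> // /pairing_solve e Qc.
have {}e := e q'0 Q'0; move/(mulfI p0): e; rewrite Qc mulfK // => ->.
by rewrite divfK.
Qed.

Section Isomorphism.
Variables (V W : lmodType rat) (f : {symmetric V}) (g : {symmetric W}).
Variables (R : set V) (R' : set W) (phi : {linear V -> W}).
Hypotheses (HR : is_LEARS f R) (HR' : is_LEARS g R').
Hypothesis iso : root_iso setT R setT R' phi.

(** The pairing is determined by root strings, which [phi] transports. *)
Lemma pairing_iso a b : R a -> R b ->
  pairing g (phi b) (phi a) = pairing f b a.
Proof.
move=> Ra Rb; have img := root_iso_img iso.
apply: (pairing_unique HR'); try exact: img.
move=> k; rewrite -!linearZ -!linearB => h; apply: img.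
have Rk : R (b - k *: a) by apply: (root_iso_preim iso _ _ h).
have := root_reflection HR Ra Rk.
rewrite -scaleNr pairing_mulD pairing_self ?(root_sq_neq0 HR) //.
suff -> : b + - k *: a - (pairing f b a + - k * 2) *: a
  = b - (pairing f b a - k) *: a by [].
rewrite -addrA; congr (_ + _); rewrite -!scaleNr -scalerDl.
by congr (_ *: _); ring.
Qed.

(** Pairings are preserved, so the ratio of squared lengths of [phi a] and [a]
    is the same for non-orthogonal roots, hence constant by irreducibility. *)
Lemma form_proportional :
  exists2 c, 0 < c & forall u v, g (phi u) (phi v) = c * f u v.
Proof.
have img := root_iso_img iso.
case: (HR) => [[_ [a Ra]] [_ span] _ _ _].
have fgt := root_sq_gt0 HR; have ggt x Rx := root_sq_gt0 HR' (img x Rx).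
pose c := g (phi a) (phi a) / f a a.
have cP x : R x -> g (phi x) (phi x) = c * f x x.
  move: x; apply: (irreducible_ind HR Ra (P := fun x => _ = c * f x x)).
    by rewrite divfK // gt_eqF ?fgt.
  move=> x y Rx Ry xy cx.
  have := pairing_iso Rx Ry; have := pairing_iso Ry Rx.
  have := fgt _ Rx; have := fgt _ Ry; have := ggt _ Rx; have := ggt _ Ry.
  rewrite /pairing ![_ (phi y) (phi x)]formC [f y x]formC.
  move=> ggy ggx fy fx e1 e2.
  by apply: (ratio_transfer xy) e2 e1 cx; rewrite gt_eqF.
exists c; first by rewrite divr_gt0 ?ggt ?fgt.
have cR x y : R x -> R y -> g (phi x) (phi y) = c * f x y.
  move=> Rx Ry; have := pairing_iso Ry Rx.
  have := fgt _ Ry; have := ggt _ Ry; rewrite /pairing cP //.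
  move=> cy fy /pairing_solve->; rewrite ?gt_eqF //.
  by rewrite mulfK ?gt_eqF // mulrC.
have cRV x y : R x -> g (phi x) (phi y) = c * f x y.
  move=> Rx; have : lspan R y by rewrite span.
  move: y; apply: lspan_min; last by move=> y; apply: cR.
  split=> [|d y z /= hy hz].
    by rewrite linear0 !form0r mulr0.
  by rewrite linearP !formE hy hz; ring.
move=> u v; have : lspan R u by rewrite span.
move: u; apply: lspan_min; last by move=> u; apply: cRV.
split=> [|d y z /= hy hz]; first by rewrite linear0 !form0l mulr0.
by rewrite linearP !formE hy hz; ring.
Qed.

End Isomorphism.

(** * Decomposition along a reflectable subspace *)

Section Decomposition.
Variables (V : lmodType rat) (f : {symmetric V}) (R V' : set V).
Hypotheses (HR : is_LEARS f R) (HV : reflectable_subspace f R V').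
Let pi := to_modrad f.
Let D := Delta_of f R V'.

Lemma to_modradP c x y : pi (c *: x + y) = c *: pi x + pi y.
Proof. by rewrite /pi raddfD /= -scale_to_modrad. Qed.

Lemma to_modradZ c x : pi (c *: x) = c *: pi x.
Proof. by rewrite /pi -scale_to_modrad. Qed.

Lemma to_modrad0 : pi 0 = 0.
Proof. by rewrite -(scale0r 0) to_modradZ scale0r. Qed.

Lemma to_modrad_sum (I : Type) (s : seq I) (c : I -> rat) (p : I -> V) :
  pi (\sum_(x <- s) c x *: p x) = \sum_(x <- s) c x *: pi (p x).
Proof.
elim: s => [|x s IH]; first by rewrite !big_nil to_modrad0.
by rewrite !big_cons to_modradP IH.
Qed.

Lemma pi_eq u v : pi u = pi v <-> radical f (u - v).
Proof. exact: to_modrad_eq. Qed.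

Lemma radical_form u v w : radical f (u - v) -> f u w = f v w.
Proof.
by move/(_ w); rewrite !formE => /eqP; rewrite subr_eq0 => /eqP.
Qed.

Lemma radical_form2 u v : radical f (u - v) -> f u u = f v v.
Proof. by move=> h; rewrite (radical_form _ h) formC (radical_form _ h). Qed.

Lemma reduced_partP (X : set (modrad f)) a :
  reduced_part X a <-> X a /\ ~ X (2^-1 *: a).
Proof.
rewrite /reduced_part; case: asboolP => [h|_] //; split=> [Xa|[]//].
by split=> // /h; rewrite scalerA mulfV // scale1r.
Qed.

(** The pairing of [r / 4] with [r] would be 1/2. *)
Lemma quarter_not_root r t : R r -> R t -> pi t = 4^-1 *: pi r -> False.
Proof.
move=> Rr Rt; rewrite -to_modradZ => /pi_eq tr.
have r0 := root_sq_neq0 HR Rr; have [n] := root_int HR Rt Rr.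
rewrite /pairing (radical_form _ tr) formZl.
rewrite (_ : 2 * _ / _ = 2^-1); last by field.
move/(congr1 (fun x => x * 2)); rewrite mulVf // => /esym.
by rewrite (_ : 2 = 2%:~R) // -intrM => /(intr_inj (x2 := 1)); lia.
Qed.

Lemma subspace_reflectable : is_subspace V'.
Proof. by case: HV => P [p [_ _ ->]]; apply: lspan_subspace. Qed.

(** A root of the quotient is reduced or twice a reduced root, so the reflectable
    base spans the whole quotient. *)
Lemma decomposition v : exists2 a, V' a & radical f (v - a).
Proof.
case: HV => P [p [[_ _ spanP _] hp eV]].
have lift x : lspan P x -> exists2 a, V' a & pi a = x.
  move: x; apply: lspan_min; last first.
    move=> x Px; exists (p x); last exact: (hp x Px).2.
    by rewrite eV; apply: sub_lspan; exists x.
  split=> [|c _ _ [a Va <-] [b Vb <-]].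
    by exists 0; [exact: subspace_reflectable.1 | rewrite /pi raddf0].
  exists (c *: a + b); last by rewrite to_modradP.
  by apply: subspace_reflectable.2.
have [_ [_ spanR] _ _ _] := HR.
have : lspan R v by rewrite spanR.
move: v; apply: (lspan_min (B := [set v | exists2 a, V' a & radical f (v - a)])) => /=.
  split=> [|c x y [a Va xa] [b Vb yb]].
    exists 0; first exact: subspace_reflectable.1.
    by rewrite subr0; apply: (radical_subspace f).1.
  exists (c *: a + b); first by apply: subspace_reflectable.2.
  rewrite opprD addrACA -scalerBr; exact: (radical_subspace f).2.
move=> r Rr; suff : lspan P (pi r) by case/lift=> a Va /esym/pi_eq; exists a.
rewrite spanP; have Xr : (pi @` R) (pi r) by exists r.
have [[t Rt tr]|nh] := pselect ((pi @` R) (2^-1 *: pi r)); last first.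
  by apply: sub_lspan; apply/reduced_partP.
rewrite -[pi r](scalerK (_ : 2^-1 != 0 :> rat)) //.
apply: (subspaceZ _ (lspan_subspace _)).
apply: sub_lspan; apply/reduced_partP; rewrite -tr; split; first by exists t.
case=> u Ru; rewrite tr scalerA => ut; apply: quarter_not_root Rr Ru _.
by rewrite /pi ut; congr (_ *: _).
Qed.

(** A vector of [V'] is a combination of preimages of linearly independent
    classes, so it vanishes as soon as its class does. *)
Lemma reflectable_radical v : V' v -> radical f v -> v = 0.
Proof.
case: HV => P [p [[_ indep _ _] hp eV]] Vv.
suff [s [c [us sP ->]]] : exists s c, [/\ uniq s, forall x, x \in s -> P x
    & v = \sum_(x <- s) c x *: p x].
  rewrite -[X in radical f X]subr0 => /pi_eq.
  rewrite to_modrad_sum to_modrad0 => h.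
  have {}h : \sum_(x <- s) c x *: x = 0.
    by apply: etrans h; apply: eq_big_seq => x /sP Px; rewrite /pi (hp x Px).2.
  by rewrite big_seq big1 // => x xs; rewrite (indep _ _ us sP h x xs) scale0r.
move: Vv; rewrite eV; move: v; apply: lspan_min; last first.
  move=> _ [x Px <-]; exists [:: x], (fun=> 1).
  by rewrite big_seq1 scale1r; split=> // y; rewrite inE => /eqP->.
split=> [|k _ _ [s [c [us sP ->]]] [t [d [ut tP ->]]]].
  by exists [::], (fun=> 0); rewrite big_nil; split.
pose c' x := if x \in s then c x else 0; pose d' x := if x \in t then d x else 0.
exists (undup (s ++ t)), (fun x => k * c' x + d' x); split.
- exact: undup_uniq.
- by move=> x; rewrite mem_undup mem_cat => /orP[/sP|/tP].
- under [RHS]eq_bigr do rewrite scalerDl -scalerA.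
  rewrite big_split /= -scaler_sumr; congr (_ *: _ + _).
    rewrite -[RHS](big_uniq_sub (s := s)) ?undup_uniq //.
    + by apply: eq_big_seq => x xs; rewrite /c' xs.
    + by move=> x xs; rewrite mem_undup mem_cat xs.
    + by move=> x _ /negbTE xs; rewrite /c' xs scale0r.
  rewrite -[RHS](big_uniq_sub (s := t)) ?undup_uniq //.
  + by apply: eq_big_seq => x xs; rewrite /d' xs.
  + by move=> x xs; rewrite mem_undup mem_cat xs orbT.
  + by move=> x _ /negbTE xs; rewrite /d' xs scale0r.
Qed.

Lemma Delta_sub : D `<=` V'.
Proof. by move=> a []. Qed.

Lemma Delta_root a : D a -> exists2 r, R r & radical f (r - a).
Proof. by case=> _ [s hs Rs]; exists (a + s) => //; rewrite addrAC subrr add0r. Qed.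

Lemma root_Delta a r : V' a -> R r -> radical f (r - a) -> D a.
Proof. by move=> Va Rr ra; split=> //; exists (r - a); rewrite // addrC subrK. Qed.

Lemma Delta_sq_gt0 a : D a -> 0 < f a a.
Proof.
by case/Delta_root=> r Rr ra; rewrite -(radical_form2 ra) (root_sq_gt0 HR).
Qed.

Lemma Delta_sq_le4 a b : D a -> D b -> f b b <= 4 * f a a.
Proof.
case/Delta_root=> r Rr /radical_form2 <- /Delta_root[t Rt /radical_form2 <-].
exact: root_sq_le4 HR _ _ _ _.
Qed.

Lemma short_Delta_exists : short_roots f D !=set0.
Proof.
have [r Rr rmin] := shortest_root_exists HR; have [a Va ra] := decomposition r.
exists a; split; first exact: root_Delta Rr ra.
move=> b /Delta_root[t Rt /radical_form2 <-].
by rewrite -(radical_form2 ra); apply: rmin.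
Qed.

(** Reflections in the chosen preimages of the base stay inside [R] and [V'], so
    the part of [R] in [V'] contains a lift of every reduced root. *)
Lemma reduced_Delta_root a : D a -> ~ D (2^-1 *: a) -> R a.
Proof.
move=> Da nD; have Va := Da.1; case: (HV) => P [p [[_ _ _ gen] hp eV]].
have pV x : P x -> V' (p x) by move=> Px; rewrite eV; apply: sub_lspan; exists x.
have /gen [s [b [sP Pb e]]] : reduced_part (pi @` R) (pi a).
  apply/reduced_partP; split.
    by have [r Rr /pi_eq] := Delta_root Da; exists r.
  rewrite -to_modradZ => -[r Rr /pi_eq rt]; apply: nD; apply: root_Delta Rr rt.
  by apply: subspaceZ => //; apply: subspace_reflectable.
suff [r [Rr Vr er]] : exists r, [/\ R r, V' r & pi r = pi a].
  suff -> : a = r by [].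
  apply/subr0_eq; apply: reflectable_radical; last exact/pi_eq/esym.
  by apply: subspaceB => //; apply: subspace_reflectable.
rewrite {}e; elim: s sP => [|c s IH] sP /=.
  by exists (p b); split; [exact: (hp b Pb).1 | exact: pV | exact: (hp b Pb).2].
have [r [Rr Vr <-]] : exists r, [/\ R r, V' r &
    pi r = foldr (reflection (@modrad_form V f)) b s].
  by apply: IH => x xs; apply: sP; rewrite inE xs orbT.
have Pc : P c by apply: sP; rewrite inE eqxx.
exists (r - pairing f r (p c) *: p c); split.
- by apply: root_reflection => //; apply: (hp c Pc).1.
- apply: subspaceB => //; try exact: subspace_reflectable.
  by apply: subspaceZ; [exact: subspace_reflectable | exact: pV].
- rewrite /reflection /pairing -[in RHS](hp c Pc).2 !modrad_formE.
  by rewrite -scaleNr [r + _]addrC to_modradP scaleNr addrC.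
Qed.

(** Half a shortest root would be shorter still. *)
Lemma short_Delta_root a : short_roots f D a -> R a.
Proof.
case=> Da amin; apply: reduced_Delta_root => // /amin; rewrite !formE.
by have := Delta_sq_gt0 Da; lra.
Qed.

(** Squared lengths differ at most by a factor 4, so if half of [a] were a root it
    would be short and [a] would be extra long. *)
Lemma long_Delta_root a : long_roots f D a -> R a.
Proof.
case=> Da nsx; apply: reduced_Delta_root => // Dh; apply: nsx; right; split=> //.
exists (2^-1 *: a); last by rewrite scalerA mulfV // scale1r.
split=> // b Db; rewrite !formE.
by have := Delta_sq_le4 Db Da; lra.
Qed.

End Decomposition.

(** * The first part *)

Section FirstPart.
Variables (V1 V2 : lmodType rat) (f1 : {symmetric V1}) (f2 : {symmetric V2}).
Variables (R1 V1' : set V1) (R2 V2' : set V2).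
Variables (phi : {linear V1 -> V2}) (zeta : V1 -> V2).
Hypotheses (HR1 : is_LEARS f1 R1) (HR2 : is_LEARS f2 R2).
Hypothesis HV1 : reflectable_subspace f1 R1 V1'.
Hypothesis HV2 : reflectable_subspace f2 R2 V2'.
Hypothesis iso : root_iso setT R1 setT R2 phi.
Hypothesis zetaE :
  forall v, V1' v -> zeta v = proj_along V2' (radical f2) (phi v).
Let D1 := Delta_of f1 R1 V1'.
Let D2 := Delta_of f2 R2 V2'.

Lemma radical_iso v : radical f2 (phi v) <-> radical f1 v.
Proof.
have [c c0 fE] := form_proportional HR1 HR2 iso.
split=> h w.
  by have := h (phi w); rewrite fE => /eqP; rewrite mulf_eq0 gt_eqF //= => /eqP.
case: iso => _ [_ _ /(_ w Logic.I)[u _ <-]] _.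
by rewrite fE h mulr0.
Qed.

Lemma zetaP v : V1' v -> V2' (zeta v) /\ radical f2 (phi v - zeta v).
Proof.
move=> Vv; rewrite zetaE //.
have [a Va ra] := decomposition HR2 HV2 (phi v).
by apply: (xgetPex 0 (P := [set a | V2' a /\ radical f2 (phi v - a)])); exists a.
Qed.

Lemma component_unique u a b : V2' a -> V2' b ->
  radical f2 (u - a) -> radical f2 (u - b) -> a = b.
Proof.
move=> Va Vb ra rb; apply/subr0_eq; apply: (reflectable_radical HV2).
  exact: subspaceB (subspace_reflectable HV2) Va Vb.
suff -> : a - b = (u - b) - (u - a).
  exact: subspaceB (radical_subspace f2) rb ra.
by rewrite [RHS]addrC opprB addrA subrK.
Qed.

Lemma zeta_component a v : V1' a -> radical f1 (v - a) ->
  radical f2 (phi v - zeta a).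
Proof.
move=> Va /radical_iso; rewrite linearB => h.
have := subspaceD (radical_subspace f2) h (zetaP Va).2.
by rewrite addrA subrK.
Qed.

Lemma zeta_iso : root_iso V1' D1 V2' D2 zeta.
Proof.
have sV1 := subspace_reflectable HV1; have sV2 := subspace_reflectable HV2.
split.
- move=> c x y Vx Vy; have [zx rx] := zetaP Vx; have [zy ry] := zetaP Vy.
  have [zxy rxy] := zetaP (sV1.2 c _ _ Vx Vy).
  apply: component_unique rxy _ => //; first exact: sV2.2.
  rewrite linearP opprD addrACA -scalerBr.
  exact: (radical_subspace f2).2.
- split.
  + by move=> v /zetaP[].
  + move=> x y; rewrite !inE => Vx Vy e; apply/subr0_eq.
    apply: (reflectable_radical HV1); first exact: subspaceB.
    apply/radical_iso; rewrite linearB.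
    have := subspaceB (radical_subspace f2) (zetaP Vx).2 (zetaP Vy).2.
    by rewrite e opprB addrA subrK.
  + move=> w Vw; case: iso => _ [_ _ /(_ w Logic.I)[v _ vw]] _.
    have [a Va ra] := decomposition HR1 HV1 v.
    exists a => //; apply: (component_unique (u := w)) => //.
    * exact: (zetaP Va).1.
    * by rewrite -vw; apply: zeta_component.
    * by rewrite subrr; apply: (radical_subspace f2).1.
- apply/seteqP; split=> [_ [a Da <-]|b Db].
    have [r Rr ra] := Delta_root Da; have Va := Delta_sub Da.
    apply: (root_Delta (r := phi r)); first exact: (zetaP Va).1.
      exact: root_iso_img iso _ Rr.
    exact: zeta_component.
  have [r2 Rr2 rb] := Delta_root Db.
  have [r Rr er] : exists2 r, R1 r & phi r = r2.
    by case: iso => _ _ e; move: Rr2; rewrite -e => -[r Rr <-]; exists r.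
  have [a Va ra] := decomposition HR1 HV1 r.
  exists a; first exact: root_Delta Rr ra.
  apply: (component_unique (u := r2)) => //.
  + exact: (zetaP Va).1.
  + exact: Delta_sub Db.
  + by rewrite -er; apply: zeta_component.
Qed.

(** Write [phi (a + s)] as [zeta a] plus the radical vector
    [(phi a - zeta a) + phi s]. *)
Lemma fibre_iso a : V1' a ->
  phi @` [set s | radical f1 s /\ R1 (a + s)] =
  set_shift [set s | radical f2 s /\ R2 (zeta a + s)] (phi a - zeta a).
Proof.
move=> Va; have [za ra] := zetaP Va; apply/seteqP; split.
  move=> _ [s [rs Rs] <-]; exists (phi s + (phi a - zeta a)); last by rewrite addrK.
  split; first by apply: subspaceD (radical_subspace f2) _ ra; apply/radical_iso.
  suff -> : zeta a + (phi s + (phi a - zeta a)) = phi (a + s).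
    exact: root_iso_img iso _ Rs.
  by rewrite linearD addrCA [zeta a + _]addrC subrK addrC.
move=> _ [t [rt Rt] <-].
case: (iso) => _ [_ _ surj] _.
have [s _ es] := surj (t - (phi a - zeta a)) Logic.I.
exists s => //; split.
  by apply/radical_iso; rewrite es; apply: subspaceB (radical_subspace f2) rt ra.
apply: (root_iso_preim iso) => //; rewrite linearD es.
suff -> : phi a + (t - (phi a - zeta a)) = zeta a + t by [].
by rewrite opprB addrCA addrA [t + phi a]addrC addrAC -!addrA addrCA addNKr addrC.
Qed.

(** When [a] itself is a root, the shift above lies in the fibre over [zeta a]; this
    gives membership of the shifts in the sets of the second triple. *)
Lemma fibre_origin a : V1' a -> R1 a ->
  radical f2 (phi a - zeta a) /\ R2 (zeta a + (phi a - zeta a)).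
Proof.
move=> Va Ra; split; first exact: (zetaP Va).2.
by rewrite addrC subrK; apply: root_iso_img iso _ Ra.
Qed.

Lemma zeta_triples S1 L1 E1 S2 L2 E2 :
  associated_triple f1 R1 V1' S1 L1 E1 -> associated_triple f2 R2 V2' S2 L2 E2 ->
  triples_related (long_roots f1 D1 !=set0) (extra_long_roots f1 D1 !=set0)
    phi S1 L1 E1 S2 L2 E2.
Proof.
move=> [[_ S1E] L1E E1E] [[_ S2E] L2E E2E].
have [c c0 fE] := form_proportional HR1 HR2 iso.
have DV1 : D1 `<=` V1' by apply: Delta_sub.
have sim a : D1 a -> f2 (zeta a) (zeta a) = c * f1 a a.
  by move=> /DV1 /zetaP[_ h]; rewrite -(radical_form2 h) fE.
have sV1 := subspace_reflectable HV1.
have shE := similar_short zeta_iso c0 sim.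
have exE := similar_extra sV1 zeta_iso DV1 c0 sim.
have lgE := similar_long sV1 zeta_iso DV1 c0 sim.
split.
  (* One short root must serve for both S and E: take half an extra long root
     whenever there is one. *)
  have [b sb eb] : exists2 b, short_roots f1 D1 b
      & extra_long_roots f1 D1 !=set0 -> D1 (2 *: b).
    have [[a [Da [b sb ab]]]|nE] := pselect (extra_long_roots f1 D1 !=set0).
      by exists b => // _; rewrite -ab.
    by have [b sb] := short_Delta_exists HR1 HV1; exists b.
  have Rb := short_Delta_root HR1 HV1 sb; have Vb := DV1 _ sb.1.
  have sb2 : short_roots f2 D2 (zeta b) by apply/shE => //; case: sb.
  exists (phi b - zeta b).
    by rewrite -(S2E _ sb2); apply: fibre_origin.
  split; first by rewrite -(S1E _ sb) -(S2E _ sb2); apply: fibre_iso.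
  move=> hE; have D2b := eb hE.
  have xb : extra_long_roots f1 D1 (2 *: b) by split=> //; exists b.
  have xb2 : extra_long_roots f2 D2 (zeta (2 *: b)) by apply/exE.
  have [_ E1h] := E1E hE.
  have [_ E2h] := E2E (ex_intro _ _ xb2).
  rewrite -(E1h _ xb) -(E2h _ xb2) fibre_iso; last exact: DV1.
  by rewrite linearZ (root_isoZ sV1 zeta_iso) // scalerBr.
move=> hL; have [b lb] := hL; have Db : D1 b by case: lb.
have lb2 : long_roots f2 D2 (zeta b) by apply/lgE.
have [_ L1h] := L1E hL; have [_ L2h] := L2E (ex_intro _ _ lb2).
exists (phi b - zeta b).
  rewrite -(L2h _ lb2); apply: fibre_origin; first exact: DV1.
  exact: long_Delta_root HR1 HV1 _ lb.
by rewrite -(L1h _ lb) -(L2h _ lb2); apply: fibre_iso; apply: DV1.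
Qed.

End FirstPart.

(** * Shears between the systems of two triples *)

Section Stabilizers.
Variable W : lmodType rat.
Implicit Types (A B : set W) (u : W).

(** The conditions of admissibility enter the second part only through the
    translations that preserve a set. *)
Definition stab A u : Prop := forall x, A x <-> A (x + u).

Lemma stab0 A : stab A 0.
Proof. by move=> x; rewrite addr0. Qed.

Lemma stabD A u v : stab A u -> stab A v -> stab A (u + v).
Proof. by move=> hu hv x; rewrite addrA; apply: iff_trans (hu x) (hv _). Qed.

Lemma stabN A u : stab A u -> stab A (- u).
Proof. by move=> hu x; have [] := hu (x - u); rewrite subrK; split. Qed.

(** Closure under all translations by multiples of [B] gives the converse
    inclusion because [B] is symmetric. *)
Lemma stab_closed A B c : (forall b, B b -> B (- b)) ->
  (forall x b, A x -> B b -> A (x + c *: b)) -> forall b, B b -> stab A (c *: b).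
Proof.
move=> BN AB b Bb x; split=> [/AB|Ax]; first exact.
by have := AB _ _ Ax (BN _ Bb); rewrite scalerN addrK.
Qed.

Lemma stab_add A B c : (forall b, B b -> B (- b)) ->
  set_add (set_scale c B) A `<=` A -> forall b, B b -> stab A (c *: b).
Proof.
move=> BN AB; apply: stab_closed => // x b Ax Bb; apply: AB.
by exists (c *: b); [exists b | exists x => //; rewrite addrC].
Qed.

Lemma stab_add1 A B : (forall b, B b -> B (- b)) ->
  set_add A B `<=` A -> forall b, B b -> stab A b.
Proof.
move=> BN AB b Bb; rewrite -[b]scale1r; apply: stab_closed Bb => // x d Ax Bd.
by apply: AB; exists x => //; exists d => //; rewrite scale1r.
Qed.

Lemma reflection_spaceN A : reflection_space A -> pointed A ->
  forall a, A a -> A (- a).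
Proof.
move=> hA A0 a Aa; apply: hA; exists a => //; exists (- 2 *: a); first by exists a.
by rewrite scaleNr scaler_nat mulr2n opprD addrA subrr sub0r.
Qed.

Lemma stab_reflection A : reflection_space A -> pointed A ->
  forall a, A a -> stab A (2 *: a).
Proof.
move=> hA A0; have AN := reflection_spaceN hA A0.
apply: stab_closed => // x b Ax Ab; apply: hA.
exists x => //; exists (2 *: b) => //; exists (- b); first exact: AN.
by rewrite scalerN scaleNr opprK.
Qed.

Lemma stab_subgroup A : is_subgroup A -> forall a, A a -> stab A a.
Proof.
move=> [A0 AB]; have AN b : A b -> A (- b) by rewrite -sub0r; apply: AB.
move=> a Aa; rewrite -[a]scale1r; apply: stab_closed Aa => // x b Ax /AN Ab.
by rewrite scale1r -[b]opprK; apply: AB.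
Qed.

Lemma subgroup_gen_subgroup A : is_subgroup (subgroup_gen A).
Proof.
split=> [H [[H0 _] _] //|x y hx hy H [sH AH]].
by apply: sH.2; [apply: hx | apply: hy].
Qed.

End Stabilizers.

(** Shearing along such a [g] translates each fibre of R(S - s, L - l, E - 2s)
    onto the corresponding fibre of R(S, L, E). *)
Definition adapted (V W : lmodType rat) (f : V -> V -> rat) (D : set V)
    (S L E : set W) (s l : W) (g : V -> W) : Prop :=
  [/\ forall (c : rat) x y, g (c *: x + y) = c *: g x + g y,
      forall a, short_roots f D a -> stab S (g a - s),
      forall a, long_roots f D a -> stab L (g a - l)
    & forall a, extra_long_roots f D a -> stab E (g a - 2 *: s)].

Section Shear.
Variables (V1 V2 W1 W2 : lmodType rat) (f1 : {symmetric V1}) (f2 : {symmetric V2}).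
Variables (D1 : set V1) (D2 : set V2) (S1 L1 E1 : set W1) (S2 L2 E2 : set W2).
Variables (zeta : {linear V1 -> V2}) (phi : {linear W1 -> W2}).
Variables (g : V1 -> W2) (s l : W2).
Hypotheses (HD1 : is_LEARS f1 D1) (HD2 : is_LEARS f2 D2).
Hypotheses (iso : root_iso setT D1 setT D2 zeta) (phi_bij : bijective phi).
Hypothesis gP : adapted f1 D1 S2 L2 E2 s l g.

Definition shear (x : (V1 * W1)%type) : (V2 * W2)%type :=
  (zeta x.1, g x.1 + phi x.2).

Lemma shear_linear : linear shear.
Proof.
case: gP => glin _ _ _ c x y; apply/pair_equal_spec; split; rewrite /= ?linearP //.
by rewrite glin scalerDr addrACA.
Qed.

Lemma shear_fibre (T1 : set W1) (T2 : set W2) t a w :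
  phi @` T1 = set_shift T2 t -> stab T2 (g a - t) ->
  T1 w <-> T2 (g a + phi w).
Proof.
move=> eT st; have inj := bij_inj phi_bij.
have -> : T1 w <-> T2 (phi w + t).
  split=> [Tw|Tw].
    have : (phi @` T1) (phi w) by exists w.
    by rewrite eT => -[x Tx <-]; rewrite subrK.
  have : set_shift T2 t (phi w) by exists (phi w + t); rewrite ?addrK.
  by rewrite -eT => -[x Tx /inj <-].
apply: iff_trans (st _) _; suff -> : phi w + t + (g a - t) = g a + phi w by [].
by rewrite -addrA [t + _]addrC subrK addrC.
Qed.

Lemma shear_iso :
  phi @` S1 = set_shift S2 s ->
  (long_roots f1 D1 !=set0 -> phi @` L1 = set_shift L2 l) ->
  (extra_long_roots f1 D1 !=set0 -> phi @` E1 = set_shift E2 (2 *: s)) ->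
  root_iso setT (LEARS_of_triple f1 D1 S1 L1 E1)
    setT (LEARS_of_triple f2 D2 S2 L2 E2) shear.
Proof.
move=> eS eL eE; case: (gP) => glin gS gL gE.
have [c c0 fE] := form_proportional HD1 HD2 iso.
have sim a : D1 a -> f2 (zeta a) (zeta a) = c * f1 a a by rewrite fE.
have shE := similar_short iso c0 sim.
have exE := similar_extra (subspaceT _) iso (@subsetT _ _) c0 sim.
have lgE := similar_long (subspaceT _) iso (@subsetT _ _) c0 sim.
have mem v w : LEARS_of_triple f1 D1 S1 L1 E1 (v, w) <->
    LEARS_of_triple f2 D2 S2 L2 E2 (shear (v, w)).
  have pre : D2 (zeta v) -> D1 v by apply: (root_iso_preim iso).
  rewrite /LEARS_of_triple /=; split=> -[[[sv Sw]|[lv Lw]]|[ev Ew]].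
  - left; left; split; first by apply/shE => //; case: sv.
    by apply/(shear_fibre w eS (gS _ sv)).
  - left; right; split; first by apply/lgE => //; case: lv.
    by apply/(shear_fibre w (eL _) (gL _ lv)) => //; exists v.
  - right; split; first by apply/exE => //; case: ev.
    by apply/(shear_fibre w (eE _) (gE _ ev)) => //; exists v.
  - have {}sv : short_roots f1 D1 v by apply/shE => //; apply/pre; case: sv.
    by left; left; split=> //; apply/(shear_fibre w eS (gS _ sv)).
  - have {}lv : long_roots f1 D1 v by apply/lgE => //; apply/pre; case: lv.
    left; right; split=> //.
    by apply/(shear_fibre w (eL _) (gL _ lv)) => //; exists v.
  - have {}ev : extra_long_roots f1 D1 v by apply/exE => //; apply/pre; case: ev.
    right; split=> //.
    by apply/(shear_fibre w (eE _) (gE _ ev)) => //; exists v.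
have [phi' _ phi'K] := phi_bij.
have surj y : exists x, shear x = y.
  case: y => v w; case: (iso) => _ [_ _ /(_ v Logic.I)[x _ <-]] _.
  exists (x, phi' (w - g x)); rewrite /shear /= phi'K addrC subrK //.
split.
- by move=> k x y _ _; apply: shear_linear.
- split=> // [x y _ _|y _]; last by have [x] := surj y; exists x.
  case: x y => [v w] [v' w'] [/(root_iso_inj iso Logic.I Logic.I) <-].
  by move/addrI/(bij_inj phi_bij) <-.
- apply/seteqP; split=> [_ [[v w] h <-]|y h]; first exact/mem.
  by have [[v w] e] := surj y; exists (v, w) => //; apply/mem; rewrite e.
Qed.

Lemma shear_iso_exists :
  phi @` S1 = set_shift S2 s ->
  (long_roots f1 D1 !=set0 -> phi @` L1 = set_shift L2 l) ->
  (extra_long_roots f1 D1 !=set0 -> phi @` E1 = set_shift E2 (2 *: s)) ->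
  exists Phi : {linear (V1 * W1)%type -> (V2 * W2)%type},
    root_iso setT (LEARS_of_triple f1 D1 S1 L1 E1)
      setT (LEARS_of_triple f2 D2 S2 L2 E2) Phi.
Proof.
pose lin := GRing.isLinear.Build rat (V1 * W1)%type (V2 * W2)%type *:%R shear
  shear_linear.
pose Phi : {linear (V1 * W1)%type -> (V2 * W2)%type} := HB.pack shear lin.
by move=> eS eL eE; exists Phi; apply: shear_iso.
Qed.

End Shear.

(** * Finitely supported vectors *)

Section FinitelySupported.
Variable I : eqType.
Implicit Types (x y : I -> rat^o) (s : seq I).

Definition supports s x := uniq s /\ forall i, x i != 0 -> i \in s.

Definition finsupp x := exists s, supports s x.

(** The linear form equal to 1 on every [eps i]. For infinite [I] no finite index
    set works for all vectors, so the value is chosen through any support. *)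
Definition total x : rat :=
  xget 0 [set t | exists2 s, supports s x & t = \sum_(i <- s) x i].

Lemma supports_sum s t x : supports s x -> supports t x ->
  \sum_(i <- s) x i = \sum_(i <- t) x i.
Proof.
have key r : supports r x -> {subset r <= undup (s ++ t)} ->
    \sum_(i <- r) x i = \sum_(i <- undup (s ++ t)) x i.
  move=> [ur xr] sub; apply: big_uniq_sub; rewrite ?undup_uniq // => i _.
  by apply: contraNeq => /xr.
by move=> hs ht; rewrite !key // => i ir; rewrite mem_undup mem_cat ir ?orbT.
Qed.

Lemma totalE s x : supports s x -> total x = \sum_(i <- s) x i.
Proof.
move=> hs; have [t ht ->] : exists2 s, supports s x & total x = \sum_(i <- s) x i.
  apply: (xgetPex 0 (P := [set t | exists2 s, supports s x & t = \sum_(i <- s) x i])).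
  by exists (\sum_(i <- s) x i), s.
exact: supports_sum.
Qed.

Lemma common_support x y : finsupp x -> finsupp y ->
  exists s, supports s x /\ supports s y.
Proof.
move=> [s [us hs]] [t [ut ht]]; exists (undup (s ++ t)).
split; split; rewrite ?undup_uniq // => i; rewrite mem_undup mem_cat.
  by move=> /hs ->.
by move=> /ht ->; rewrite orbT.
Qed.

Lemma supports_lin s c x y : supports s x -> supports s y ->
  supports s (c *: x + y).
Proof.
move=> [us hx] [_ hy]; split=> // i.
have [xi0|/hx //] := eqVneq (x i) 0; have [yi0|/hy //] := eqVneq (y i) 0.
by rewrite (_ : _ i = c * x i + y i) // xi0 yi0 mulr0 addr0 eqxx.
Qed.

Lemma finsupp_subspace : is_subspace finsupp.
Proof.
split=> [|c x y fx fy]; first by exists [::]; split=> // i; rewrite eqxx.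
have [s [hx hy]] := common_support fx fy.
by exists s; apply: supports_lin.
Qed.

Lemma total_lin c x y : finsupp x -> finsupp y ->
  total (c *: x + y) = c * total x + total y.
Proof.
move=> fx fy; have [s [hx hy]] := common_support fx fy.
rewrite !(totalE (s := s)) //; last exact: supports_lin.
by rewrite mulr_sumr -big_split.
Qed.

Lemma supports_mull s x y : supports s x -> supports s (fun i => x i * y i).
Proof. by move=> [us hx]; split=> // i; rewrite mulf_eq0 negb_or => /andP[/hx]. Qed.

Definition dot x y : rat := total (fun i => x i * y i).

Lemma dotE s x y : supports s x -> dot x y = \sum_(i <- s) x i * y i.
Proof. by move=> hs; apply: totalE; apply: supports_mull. Qed.

Lemma dotC x y : dot x y = dot y x.
Proof.
by rewrite /dot; congr total; apply/funext => i; rewrite mulrC.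
Qed.

Lemma dot_sub_sq m x y : finsupp x -> finsupp y ->
  dot (y - m *: x) (y - m *: x) = dot y y - 2 * m * dot x y + m ^+ 2 * dot x x.
Proof.
move=> fx fy; have [s [hx hy]] := common_support fx fy.
rewrite !(dotE _ hx) !(dotE _ hy) (dotE (s := s)); last first.
  by rewrite addrC -scaleNr; apply: supports_lin.
rewrite !mulr_sumr -sumrB -big_split /=; apply: eq_bigr => i _.
rewrite (_ : (y - _) i = y i - m * x i) //; ring.
Qed.

Lemma epsE (i j : I) : eps i j = (i == j)%:R.
Proof. by []. Qed.

Lemma supports_eps i : supports [:: i] (eps i).
Proof.
by split=> // j; rewrite epsE inE [j == i]eq_sym; case: (i == j).
Qed.

Lemma total_eps i : total (eps i) = 1.
Proof. by rewrite (totalE (supports_eps i)) big_seq1 epsE eqxx. Qed.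

Lemma finsupp_eps i : finsupp (eps i).
Proof. by exists [:: i]; apply: supports_eps. Qed.

Lemma finsuppD x y : finsupp x -> finsupp y -> finsupp (x + y).
Proof. exact: subspaceD finsupp_subspace. Qed.

Lemma finsuppZ c x : finsupp x -> finsupp (c *: x).
Proof. exact: subspaceZ finsupp_subspace. Qed.

Lemma D_finsupp x : D_model I x -> finsupp x.
Proof.
case=> i [j [b [c [_ ->]]]]; apply: finsuppZ; apply: finsuppD.
  exact: finsupp_eps.
by apply: finsuppZ; apply: finsupp_eps.
Qed.

Lemma BC_finsupp x : BC_model I x -> finsupp x.
Proof.
case=> [[[i [b ->]]|]|[|[i [b ->]]]]; try exact: D_finsupp.
  by apply: finsuppZ; apply: finsupp_eps.
by do 2!apply: finsuppZ; apply: finsupp_eps.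
Qed.

Lemma D_norm x : D_model I x -> dot x x = 2.
Proof.
case=> i [j [b [c [ij ->]]]]; set y := (X in dot X X).
have yE t : y t = (-1) ^+ b * (eps i t + (-1) ^+ c * eps j t) by [].
rewrite (dotE (s := [:: i; j])).
  rewrite big_cons big_seq1 !yE !epsE !eqxx [j == i]eq_sym (negbTE ij).
  by case: b {y yE}; case: c => /=; ring.
split=> [|t]; first by rewrite /= inE ij.
rewrite yE !epsE !inE ![_ == t]eq_sym.
case: (t == i); case: (t == j) => //=.
by rewrite !(mulr0, addr0) eqxx.
Qed.

Lemma eps_norm (i : I) (c : rat) : dot (c *: eps i) (c *: eps i) = c ^+ 2.
Proof.
have cE t : (c *: eps i) t = c * eps i t by [].
rewrite (dotE (s := [:: i])).
  by rewrite big_seq1 cE epsE eqxx mulr1 expr2.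
split=> // k; rewrite cE epsE inE [k == i]eq_sym.
by case: (i == k) => //=; rewrite mulr0 eqxx.
Qed.

Lemma B_norm x : B_model I x -> dot x x = 1 \/ dot x x = 2.
Proof. by case=> [[i [b ->]]|/D_norm]; [left; rewrite eps_norm sqrr_sign|right]. Qed.

End FinitelySupported.

Lemma dot_fin (n : nat) (x : 'I_n -> rat^o) : dot x x = \sum_i x i ^+ 2.
Proof.
rewrite (dotE (s := index_enum 'I_n)); first by apply: eq_bigr => i _; rewrite expr2.
by split; [apply: index_enum_uniq | move=> i _; rewrite mem_index_enum].
Qed.

Lemma finsupp_fin (n : nat) (x : 'I_n -> rat^o) : finsupp x.
Proof.
exists (index_enum 'I_n).
by split; [apply: index_enum_uniq | move=> i _; rewrite mem_index_enum].
Qed.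

Lemma half_signs_norm (n : nat) (s : {set 'I_n}) :
  dot (half_signs s) (half_signs s) = n%:R / 4.
Proof.
rewrite dot_fin (eq_bigr (fun=> 4^-1)); last first.
  by move=> i _; rewrite /half_signs; case: (i \in s) => /=; field.
by rewrite sumr_const card_ord -[LHS]mulr_natl.
Qed.

Lemma E8_norm x : E8_model x -> dot x x = 2.
Proof.
case=> [|[s [_ ->]]]; first exact: D_norm.
by rewrite half_signs_norm.
Qed.

Lemma A_sub_D (I : eqType) : A_model I `<=` D_model I.
Proof.
move=> x [i [j [ij ->]]]; exists i, j, false, true; split=> //.
by rewrite /= expr0 scale1r expr1 scaleN1r.
Qed.

Lemma F4_norm x : F4_model x -> dot x x = 1 \/ dot x x = 2.
Proof.
by case=> [/B_norm //|[s ->]]; left; rewrite half_signs_norm.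
Qed.

Lemma G2_norm x : G2_model x -> dot x x = 2 \/ dot x x = 6.
Proof.
case=> [/A_sub_D/D_norm|[i [j [k [b [u ->]]]]]]; [by left | right].
set y := (X in dot X X).
have yE t : y t = (-1) ^+ b * (2 * eps i t - eps j t - eps k t) by [].
rewrite (dotE (s := [:: i; j; k])).
  rewrite !big_cons big_nil.
  move: u; rewrite !yE !epsE !eqxx /= !inE !negb_or => /andP[/andP[ij ik] /andP[jk _]].
  rewrite [j == i]eq_sym [k == i]eq_sym [k == j]eq_sym.
  rewrite (negbTE ij) (negbTE ik) (negbTE jk).
  by case: b {y yE} => /=; ring.
split=> // t; rewrite yE !epsE !inE ![_ == t]eq_sym.
case: (t == i); case: (t == j); case: (t == k) => //=.
by rewrite !(mulr0, subr0) eqxx.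
Qed.

(** * Coordinates in a model *)

Section Coordinates.
Variables (V : lmodType rat) (f : {symmetric V}) (D : set V).
Variables (I : eqType) (M : set (I -> rat^o)) (h : V -> I -> rat^o).

(** The inverse of the isomorphism with the model is more convenient than the
    isomorphism: it is defined on all of [V], with no condition on spans. *)
Definition coordinates : Prop :=
  [/\ forall (c : rat) x y, h (c *: x + y) = c *: h x + h y, injective h,
      range h = lspan M & forall v, D v <-> M (h v)].

Lemma iso_coordinates_inj (phi : (I -> rat^o) -> V) :
  root_iso (lspan M) M setT D phi -> (forall v, lspan M (h v) /\ phi (h v) = v) ->
  coordinates.
Proof.
move=> iso hP; have sM := lspan_subspace M; split.
- move=> c x y; apply: (root_iso_inj iso); first exact: (hP _).1.
    by apply: sM.2; apply: (hP _).1.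
  case: iso => lin _ _; rewrite lin; try exact: (hP _).1.
  by rewrite !(hP _).2.
- by move=> x y e; rewrite -(hP x).2 e (hP y).2.
- apply/seteqP; split=> [_ [v _ <-]|x Mx]; first exact: (hP v).1.
  exists (phi x) => //; apply: (root_iso_inj iso) => //; first exact: (hP _).1.
  exact: (hP _).2.
- move=> v; split=> [Dv|Mv].
    apply: (root_iso_preim iso); [exact: sub_lspan | exact: (hP v).1|].
    by rewrite (hP v).2.
  by rewrite -(hP v).2; apply: root_iso_img iso _ Mv.
Qed.

End Coordinates.

Lemma iso_coordinates (V : lmodType rat) (D : set V) (I : eqType)
    (M : set (I -> rat^o)) :
  iso_to_model D M -> exists h, coordinates D M h.
Proof.
move=> [phi iso].
have ex v : exists x, lspan M x /\ phi x = v.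
  by case: iso => _ [_ _ /(_ v Logic.I)[x Mx <-]] _; exists x.
have [h hP] := choice ex; exists h; exact: iso_coordinates_inj iso hP.
Qed.

Section RootsInCoordinates.
Variables (V : lmodType rat) (f : {symmetric V}) (D : set V).
Variables (I : eqType) (M : set (I -> rat^o)) (h : V -> I -> rat^o).
Hypotheses (HD : is_LEARS f D) (hP : coordinates D M h).

Lemma coordP c x y : h (c *: x + y) = c *: h x + h y.
Proof. by case: hP. Qed.

Lemma coord0 : h 0 = 0.
Proof. by have := coordP (-1) 0 0; rewrite scaler0 addr0 scaleN1r addNr. Qed.

Lemma coordZ c x : h (c *: x) = c *: h x.
Proof. by rewrite -[c *: x]addr0 coordP coord0 addr0. Qed.

Lemma coordD x y : h (x + y) = h x + h y.
Proof. by rewrite -{1}[x]scale1r coordP scale1r. Qed.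

Lemma coordB x y : h (x - y) = h x - h y.
Proof. by rewrite coordD -scaleN1r coordZ scaleN1r. Qed.

Lemma coord_inj : injective h.
Proof. by case: hP. Qed.

Lemma coord_surj x : lspan M x -> exists v, h v = x.
Proof. by case: hP => _ _ <- _ [v _ <-]; exists v. Qed.

Lemma coord_span v : lspan M (h v).
Proof. by case: hP => _ _ <- _; exists v. Qed.

Lemma coord_root v : D v <-> M (h v).
Proof. by case: hP. Qed.

(** Any symmetry of the model that reverses the [a]-string through [b] computes pairings for the
    given form [f], through the uniqueness of the centre of a string. *)
Lemma pairing_coord n a b : D a -> D b ->
  (forall k, M (h b - k *: h a) -> M (h b - (n - k) *: h a)) -> pairing f b a = n.
Proof.
move=> Da Db sym; apply: (pairing_unique HD) => // k.
by move/coord_root; rewrite coordB coordZ => /sym; rewrite -coordZ -coordB => /coord_root.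
Qed.

Definition same_length := forall a b, D a -> D b -> f a a = f b b.

Lemma same_length_short : same_length -> long_roots f D = set0 /\
  extra_long_roots f D = set0.
Proof.
move=> eql; split; apply/seteqP; split=> // a.
  by move=> [Da []]; left; split=> // b Db; rewrite (eql a b).
move=> [Da [b [Db _] ab]]; have := eql _ _ Da Db; rewrite ab !formE.
by have := root_sq_gt0 HD Db; lra.
Qed.

(** When all vectors of the model have the same norm 2, the condition that
    [b - <b,a> a] has norm 2 forces a nonzero [<b,a>] to be the dot product. The
    latter is symmetric, so non-orthogonal roots have equal lengths. *)
Lemma simply_laced : (forall x, M x -> finsupp x /\ dot x x = 2) -> same_length.
Proof.
move=> nM a b Da Db.
apply: (irreducible_ind HD Da (P := fun b => f a a = f b b)) Db => // {b} b c Db Dc bc ->.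
have key x y : D x -> D y -> f x y != 0 -> pairing f y x = dot (h x) (h y).
  move=> Dx Dy xy; have [fx nx] := nM _ (iffLR (coord_root x) Dx).
  have [fy ny] := nM _ (iffLR (coord_root y) Dy).
  have := root_reflection HD Dx Dy; set m := pairing f y x => /coord_root.
  have m0 : m != 0.
    by rewrite /m /pairing formC !mulf_neq0 // invr_eq0 (root_sq_neq0 HD).
  rewrite coordB coordZ => /nM[_]; rewrite dot_sub_sq // nx ny => e.
  apply: (mulfI m0); apply: (mulfI (_ : 2 != 0 :> rat)) => //.
  by move: e; rewrite expr2; lra.
have := key _ _ Db Dc bc; have := key c b Dc Db; rewrite formC dotC => /(_ bc) <-.
rewrite /pairing [f c b]formC => /(congr1 (fun t => t / (2 * f b c))).
have := root_sq_neq0 HD Db; have := root_sq_neq0 HD Dc => c0 b0.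
rewrite (_ : 2 * f b c / f b b / (2 * f b c) = (f b b)^-1); last first.
  by field; rewrite b0 bc.
rewrite (_ : 2 * f b c / f c c / (2 * f b c) = (f c c)^-1); last first.
  by field; rewrite c0 bc.
by move/invr_inj.
Qed.

(** Extra long roots are twice other roots in the model as well, whatever [f] is,
    so it suffices to compare norms there. *)
Lemma no_extra_long : (forall x, M x -> finsupp x) ->
  (forall x y, M x -> M y -> dot y y != 4 * dot x x) ->
  extra_long_roots f D = set0.
Proof.
move=> fM nM; apply/seteqP; split=> // a [Da [b [Db _] ab]].
move: Da Db => /coord_root; rewrite ab coordZ => M2 /coord_root M1.
move/eqP: (nM _ _ M1 M2); apply.
have [s hs] := fM _ M1; rewrite (dotE _ hs) (dotE (s := s)).
  rewrite mulr_sumr; apply: eq_bigr => i _.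
  by rewrite (_ : (2 *: _) i = 2 * h b i) //; ring.
rewrite -[2 *: _]addr0; apply: supports_lin => //.
by split; [case: hs | move=> i; rewrite eqxx].
Qed.

End RootsInCoordinates.

(** * Sign changes and exchanges of coordinates *)

Section Symmetries.
Variable I : eqType.
Implicit Types (x : I -> rat^o) (i j k l : I).

Definition flip l x : I -> rat^o := x - (2 * x l) *: eps l.

Definition transp i j k := if k == i then j else if k == j then i else k.

Definition swap i j x : I -> rat^o := fun k => x (transp i j k).

Lemma flip_lin l c x y : flip l (c *: x + y) = c *: flip l x + flip l y.
Proof.
apply/funext => t.
change (c * x t + y t - 2 * (c * x l + y l) * eps l t =
  c * (x t - 2 * x l * eps l t) + (y t - 2 * y l * eps l t)).
by ring.
Qed.

Lemma flip_eps l i : flip l (eps i) = (-1) ^+ (i == l) *: eps i.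
Proof.
rewrite /flip epsE; case: eqP => [->|_] /=; last by rewrite mulr0 scale0r subr0 scale1r.
by rewrite mulr1 scaler_nat mulr2n opprD addrA subrr sub0r scaleN1r.
Qed.

Lemma transpK i j : involutive (transp i j).
Proof.
move=> k; rewrite /transp; have [->|ki] := eqVneq k i.
  by rewrite eqxx; case: eqP.
have [->|kj] := eqVneq k j; first by rewrite eqxx.
by rewrite (negbTE ki) (negbTE kj).
Qed.

Lemma transpL i j : transp i j i = j.
Proof. by rewrite /transp eqxx. Qed.

Lemma transpR i j : transp i j j = i.
Proof. by rewrite /transp eqxx; case: eqP. Qed.

Lemma transp_inj i j : injective (transp i j).
Proof. exact: can_inj (transpK i j). Qed.

Lemma swap_eps i j k : swap i j (eps k) = eps (transp i j k).
Proof.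
apply/funext => t; rewrite /swap !epsE.
by rewrite -(inj_eq (@transp_inj i j)) transpK.
Qed.

Lemma swap_lin i j c x y : swap i j (c *: x + y) = c *: swap i j x + swap i j y.
Proof. by []. Qed.

Lemma swapZ i j c x : swap i j (c *: x) = c *: swap i j x.
Proof. by []. Qed.

Lemma flip0 l : flip l 0 = 0.
Proof. by rewrite /flip mulr0 scale0r subr0. Qed.

Lemma flipZ l c x : flip l (c *: x) = c *: flip l x.
Proof. by rewrite -[c *: x]addr0 flip_lin flip0 addr0. Qed.

Lemma flip_D l x : D_model I x -> D_model I (flip l x).
Proof.
case=> i [j [b [c [ij ->]]]].
exists i, j, (b (+) (i == l)), (c (+) (i == l) (+) (j == l)).
split=> //; rewrite flipZ addrC flip_lin !flip_eps addrC.
rewrite !signr_addb !scalerDr !scalerA; congr (_ + _); congr (_ *: _).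
by case: (i == l) => /=; ring.
Qed.

Lemma swap_D i j x : D_model I x -> D_model I (swap i j x).
Proof.
case=> k [l [b [c [kl ->]]]]; exists (transp i j k), (transp i j l), b, c.
rewrite (inj_eq (@transp_inj i j)); split=> //.
by rewrite swapZ addrC swap_lin !swap_eps addrC.
Qed.

Lemma flip_B l x : B_model I x -> B_model I (flip l x).
Proof.
case=> [[i [b ->]]|/(flip_D l)]; [left|by right].
by exists i, (b (+) (i == l)); rewrite flipZ flip_eps signr_addb scalerA.
Qed.

Lemma swap_B i j x : B_model I x -> B_model I (swap i j x).
Proof.
case=> [[k [b ->]]|/(swap_D i j)]; [left|by right].
by exists (transp i j k), b; rewrite swapZ swap_eps.
Qed.

Lemma flip_C l x : C_model I x -> C_model I (flip l x).
Proof.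
case=> [/(flip_D l)|[i [b ->]]]; [by left|right].
exists i, (b (+) (i == l)); rewrite !flipZ flip_eps signr_addb !scalerA.
by congr (_ *: _); ring.
Qed.

Lemma swap_C i j x : C_model I x -> C_model I (swap i j x).
Proof.
case=> [/(swap_D i j)|[k [b ->]]]; [by left|right].
by exists (transp i j k), b; rewrite !swapZ swap_eps.
Qed.

Lemma eps_sub_D i j : i != j -> D_model I (eps i - eps j).
Proof. by move=> ij; apply: A_sub_D; exists i, j. Qed.

End Symmetries.

Section OrthogonalBasis.
Variables (V : lmodType rat) (f : {symmetric V}) (D : set V).
Variables (I : eqType) (M : set (I -> rat^o)) (h : V -> I -> rat^o).
Hypotheses (HD : is_LEARS f D) (hP : coordinates D M h).
Variable r : rat.
Hypotheses (r0 : r != 0) (rM : forall i, M (r *: eps i)).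
Hypothesis DM : D_model I `<=` M.
Hypothesis flipM : forall l x, M x -> M (flip l x).
Hypothesis swapM : forall i j x, M x -> M (swap i j x).

Lemma basis_exists : exists e : I -> V, forall i, h (e i) = eps i.
Proof.
have ex i : exists v, h v = eps i.
  apply: (coord_surj hP); rewrite -(scalerK r0 (eps i)).
  by apply: (subspaceZ _ (lspan_subspace _)); apply: sub_lspan.
by have [e eP] := choice ex; exists e.
Qed.

Variable e : I -> V.
Hypothesis eP : forall i, h (e i) = eps i.

(** The sign change of coordinate [i] reverses the [eps i]-string through
    [eps j]. *)
Lemma basis_orthogonal i j : i != j -> f (e i) (e j) = 0.
Proof.
move=> ij; have De k : D (r *: e k) by apply/(coord_root hP); rewrite (coordZ hP) eP.
have : pairing f (r *: e j) (r *: e i) = 0.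
  apply: (pairing_coord HD hP) => // k.
  rewrite !(coordZ hP) !eP => /(flipM i); rewrite -scaleNr addrC scalerA.
  rewrite flip_lin flipZ !flip_eps eqxx [j == i]eq_sym (negbTE ij) /= scale1r.
  rewrite scalerA sub0r scaleNr opprK addrC scalerA.
  by suff -> : - k * r * (-1) ^+ 1 = k * r by []; ring.
rewrite /pairing => /eqP; rewrite !mulf_eq0 invr_eq0.
rewrite (negbTE (root_sq_neq0 HD (De i))) orbF /=.
by rewrite !formE !mulf_eq0 (negbTE r0) /= formC => /eqP.
Qed.

(** The exchange of coordinates [i] and [j] is the reflection in
    [eps i - eps j] and shows that [e i] pairs to 1 with [e i - e j]. *)
Lemma basis_same_length i j : f (e i) (e i) = f (e j) (e j).
Proof.
have [->//|ij] := eqVneq i j.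
have De k : D (r *: e k) by apply/(coord_root hP); rewrite (coordZ hP) eP.
have Da : D (e i - e j).
  by apply/(coord_root hP)/DM; rewrite (coordB hP) !eP; apply: eps_sub_D.
have : pairing f (r *: e i) (e i - e j) = r.
  apply: (pairing_coord HD hP) => // k.
  rewrite !(coordZ hP) (coordB hP) !eP => /(swapM i j).
  rewrite addrC -scaleNr swap_lin swapZ swap_eps transpL.
  have -> : swap i j (eps i - eps j) = eps j - eps i :> (I -> rat^o).
    by rewrite addrC -scaleN1r swap_lin !swap_eps transpL transpR scaleN1r addrC.
  suff -> : - k *: (eps j - eps i) + r *: eps j =
    r *: eps i - (r - k) *: (eps i - eps j) :> (I -> rat^o) by [].
  apply/funext => t; change (- k * (eps j t - eps i t) + r * eps j t =
    r * eps i t - (r - k) * (eps i t - eps j t)); ring.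
have := root_sq_neq0 HD Da.
rewrite /pairing !formE [f (e j) (e i)]formC (basis_orthogonal ij) => d0 E.
have : 2 * r * f (e i) (e i) = r * (f (e i) (e i) + f (e j) (e j)).
  move/(congr1 (fun t => t * (f (e i) (e i) + - 0 + (- 0 - - f (e j) (e j))))): E.
  by rewrite divfK // => E; move: E; rewrite !oppr0 !addr0 !sub0r opprK => <-; ring.
by rewrite [2 * r]mulrC -mulrA => /(mulfI r0); lra.
Qed.

End OrthogonalBasis.

(** * Types B, C and BC *)

Lemma uniq_card_atleast (J : eqType) (s : seq J) :
  uniq s -> card_atleast (size s) J.
Proof.
case: s => [|x s] us; first by rewrite /card_atleast II0.
have inj : {in `I_(size (x :: s)) &, injective (nth x (x :: s))}.
  move=> i j; rewrite !inE => si sj /eqP.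
  by rewrite nth_uniq // => /eqP.
by rewrite /card_atleast -(card_le_eql (inj_card_eq inj)); apply: subset_card_le.
Qed.

Lemma card_atleast2 (J : eqType) : card_atleast 2 J -> exists i j : J, i != j.
Proof.
move=> c2; apply: contrapT => nij.
have eqJ (i j : J) : i = j.
  by apply/eqP; apply: contrapT => /negP ij; apply: nij; exists i, j.
suff : (`I_2 #<= `I_1)%card by rewrite card_le_II.
apply: card_le_trans c2 _; have [[x _]|n] := pselect (exists x : J, True).
  apply: card_le_trans (card_image_le (fun=> x) `I_1).
  by apply: subset_card_le => y _; exists 0%N => //; apply: eqJ.
rewrite (_ : [set: J] = set0) ?card_ge0 //.
by apply/seteqP; split=> // y _; apply: n; exists y.
Qed.

Lemma two_element (J : eqType) (i0 i1 j : J) : i0 != i1 -> ~ card_atleast 3 J ->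
  j = i0 \/ j = i1.
Proof.
move=> i01 n3; have [|j0] := eqVneq j i0; [by left | right].
have [//|j1] := eqVneq j i1; case: n3.
apply: (uniq_card_atleast (s := [:: i0; i1; j])).
by rewrite /= !inE negb_or i01 [i0 == j]eq_sym j0 [i1 == j]eq_sym j1.
Qed.

Section Combinations.
Variables (W : lmodType rat) (s l : W).

(** The values of [g] are rational combinations of [s] and [l]; in coordinates,
    membership in a stabilizer becomes a divisibility of two numbers. *)
Definition comb (a b : rat) : W := a *: s + b *: l.

Lemma combD a b a' b' : comb a b + comb a' b' = comb (a + a') (b + b').
Proof. by rewrite /comb addrACA -!scalerDl. Qed.

Lemma combZ c a b : c *: comb a b = comb (c * a) (c * b).
Proof. by rewrite /comb scalerDr !scalerA. Qed.

Lemma comb_sub a b c d : comb a b - comb c d = comb (a - c) (b - d).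
Proof. by rewrite -scaleN1r combZ combD !mulN1r. Qed.

Lemma comb_l : l = comb 0 1.
Proof. by rewrite /comb scale0r add0r scale1r. Qed.

Lemma comb_cs c : c *: s = comb c 0.
Proof. by rewrite /comb scale0r addr0. Qed.

Lemma comb_s : s = comb 1 0.
Proof. by rewrite -comb_cs scale1r. Qed.

Lemma stab_int (A : set W) (n : int) u : stab A u -> stab A (n%:~R *: u).
Proof.
move=> h; have hn k : stab A (k%:R *: u).
  elim: k => [|k IH]; first by rewrite scale0r; apply: stab0.
  by rewrite -natr1 scalerDl scale1r; apply: stabD.
case: n => n; first exact: hn.
by rewrite NegzE mulrNz scaleNr; apply: stabN; apply: (hn n.+1).
Qed.

Lemma stab_comb (A : set W) (m n : int) p q a b : stab A (p *: s) ->
  stab A (q *: l) -> a = m%:~R * p -> b = n%:~R * q -> stab A (comb a b).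
Proof.
by move=> hs hl -> ->; apply: stabD; rewrite -scalerA; apply: stab_int.
Qed.

End Combinations.

Section ClassicalTypes.
Variables (V : lmodType rat) (f : {symmetric V}) (D : set V).
Variables (I : eqType) (M : set (I -> rat^o)) (h : V -> I -> rat^o).
Hypotheses (HD : is_LEARS f D) (hP : coordinates D M h).
Variables (W : lmodType rat) (S L E : set W) (s l : W).
Variable e : I -> V.
Hypothesis eP : forall i, h (e i) = eps i.

Lemma linear_ext_const (u : W) : M `<=` @finsupp I ->
  exists g : V -> W, (forall (c : rat) x y, g (c *: x + y) = c *: g x + g y) /\
    forall i, g (e i) = u.
Proof.
move=> Mf; have fh v : finsupp (h v).
  exact: lspan_min (finsupp_subspace I) Mf _ (coord_span hP v).
exists (fun v => total (h v) *: u); split=> [c x y|i].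
  by rewrite (coordP hP) total_lin // scalerDl scalerA.
by rewrite eP total_eps scale1r.
Qed.

(** Together with the constant case these are all the linear maps needed for B, C and
    BC: with more than two coordinates the same value serves for every basis vector. *)
Lemma linear_ext_point (u t : W) (i1 : I) : M `<=` @finsupp I ->
  exists g : V -> W, (forall (c : rat) x y, g (c *: x + y) = c *: g x + g y) /\
    forall i, g (e i) = if i == i1 then t else u.
Proof.
move=> Mf; have [g [glin ge]] := linear_ext_const u Mf.
exists (fun v => g v + h v i1 *: (t - u)); split=> [c x y|i].
  rewrite glin (coordP hP) (_ : (_ + _) i1 = c * h x i1 + h y i1) //.
  by rewrite scalerDl -scalerA addrACA -scalerDr.
rewrite ge eP epsE; case: eqP => _; last by rewrite scale0r addr0.
by rewrite scale1r addrC subrK.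
Qed.

(** The three shapes of the roots of B, C and BC in the orthogonal basis [e]; with
    [c] the square of a basis vector their squares are [c], [2 c] and [4 c]. *)
Definition sgl a := exists i (b : bool), a = (-1) ^+ b *: e i.
Definition dbl a := exists i j (b c : bool), i != j /\
  a = (-1) ^+ b *: (e i + (-1) ^+ c *: e j).
Definition two a := exists i (b : bool), a = (-1) ^+ b *: (2 *: e i).

Lemma coord_dbl a : D_model I (h a) <-> dbl a.
Proof.
split=> -[i [j [b [c [ij ha]]]]]; exists i, j, b, c; split=> //.
  apply: (coord_inj hP); rewrite (coordZ hP) (coordD hP) (coordZ hP).
  by rewrite !eP.
by rewrite ha (coordZ hP) (coordD hP) (coordZ hP) !eP.
Qed.

Lemma coord_B a : B_model I (h a) <-> sgl a \/ dbl a.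
Proof.
split=> [[[i [b ha]]|/coord_dbl]|[[i [b ->]]|/coord_dbl]]; try by right.
  by left; exists i, b; apply: (coord_inj hP); rewrite (coordZ hP) eP.
by left; exists i, b; rewrite (coordZ hP) eP.
Qed.

Lemma coord_C a : C_model I (h a) <-> dbl a \/ two a.
Proof.
split=> [[/coord_dbl|[i [b ha]]]|[/coord_dbl|[i [b ->]]]]; try by left.
  by right; exists i, b; apply: (coord_inj hP); rewrite !(coordZ hP) eP.
by right; exists i, b; rewrite !(coordZ hP) eP.
Qed.

Hypothesis orth : forall i j, i != j -> f (e i) (e j) = 0.
Hypothesis eqlen : forall i j, f (e i) (e i) = f (e j) (e j).

Lemma sgl_sq a i : sgl a -> f a a = f (e i) (e i).
Proof.
by case=> j [b ->]; rewrite !formE mulrA -expr2 sqrr_sign mul1r (eqlen j i).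
Qed.

Lemma dbl_sq a i : dbl a -> f a a = 2 * f (e i) (e i).
Proof.
case=> j [k [b [c [jk ->]]]].
rewrite !formE [f (e k) (e j)]formC (orth jk) (eqlen j i) (eqlen k i).
by case: b; case: c => /=; ring.
Qed.

Lemma two_sq a i : two a -> f a a = 4 * f (e i) (e i).
Proof. by case=> j [b ->]; rewrite !formE (eqlen j i); case: b => /=; ring. Qed.

Lemma basis_sq_gt0 i : f (e i) (e i) != 0 -> 0 < f (e i) (e i).
Proof. by case: HD => [[psd _] _ _ _ _] n0; rewrite lt_def n0 psd. Qed.

Lemma root_basis_sq_gt0 a i : D a -> sgl a \/ dbl a \/ two a -> 0 < f (e i) (e i).
Proof.
move=> Da k; apply: basis_sq_gt0; apply: contraTneq (root_sq_gt0 HD Da) => e0.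
suff -> : f a a = 0 by [].
by case: k => [/(sgl_sq i)|[/(dbl_sq i)|/(two_sq i)]] ->; rewrite e0 ?mulr0.
Qed.

Section BCTypes.
Hypothesis BM : B_model I `<=` M.
Hypothesis MBC : M `<=` BC_model I.

Lemma BC_cases a : D a -> sgl a \/ dbl a \/ two a.
Proof.
by move/(coord_root hP)/MBC => [/coord_B|/coord_C]; tauto.
Qed.

Lemma sgl_root a : sgl a -> D a.
Proof. by move=> sa; apply/(coord_root hP)/BM/coord_B; left. Qed.

Lemma BC_min a i : D a -> f (e i) (e i) <= f a a.
Proof.
move=> Da; have k := BC_cases Da; have := root_basis_sq_gt0 i Da k.
by case: k => [/(sgl_sq i)|[/(dbl_sq i)|/(two_sq i)]] ->; lra.
Qed.

Lemma sgl_short a : sgl a -> short_roots f D a.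
Proof.
move=> sa; split=> [|b Db]; first exact: sgl_root.
by case: (sa) => i _; rewrite (sgl_sq i sa); apply: BC_min.
Qed.

Lemma short_sgl a : short_roots f D a -> sgl a.
Proof.
case=> Da amin; have k := BC_cases Da; case: (k) => [//|nk].
have le i : f a a <= f (e i) (e i).
  by apply/amin/sgl_root; exists i, false; rewrite scale1r.
case: nk => h1; case: (h1) => i _; have := le i; have := root_basis_sq_gt0 i Da k.
  by rewrite (dbl_sq i h1); lra.
by rewrite (two_sq i h1); lra.
Qed.

Lemma BC_long_dbl a : long_roots f D a -> dbl a.
Proof.
case=> Da nsx; case: (BC_cases Da) => [/sgl_short sa|[//|[i [b ab]]]].
  by case: nsx; left.
case: nsx; right; split=> //; exists ((-1) ^+ b *: e i).
  by apply: sgl_short; exists i, b.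
by rewrite ab !scalerA mulrC.
Qed.

Lemma extra_two a : extra_long_roots f D a -> two a.
Proof.
case=> Da [b /short_sgl[i [c ->]] ->]; exists i, c.
by rewrite !scalerA mulrC.
Qed.

Lemma dbl_BC_long a : dbl a -> long_roots f D a.
Proof.
move=> da; have Da : D a by apply/(coord_root hP)/BM/coord_B; right.
have [i _] := da; have i0 := root_basis_sq_gt0 i Da (or_intror (or_introl da)).
have aE := dbl_sq i da; split=> // -[/short_sgl/(sgl_sq i)|/extra_two/(two_sq i)].
  by rewrite aE; lra.
by rewrite aE; lra.
Qed.

End BCTypes.

Section LinearCombination.
Variables (g : V -> W) (x y : I -> rat).
Hypothesis glin : forall (c : rat) u v, g (c *: u + v) = c *: g u + g v.
Hypothesis ge : forall i, g (e i) = comb s l (x i) (y i).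

Lemma lin0 : g 0 = 0.
Proof. by have := glin (-1) 0 0; rewrite scaler0 addr0 scaleN1r addNr. Qed.

Lemma linZ c u : g (c *: u) = c *: g u.
Proof. by rewrite -[c *: u]addr0 glin lin0 addr0. Qed.

Lemma linD u v : g (u + v) = g u + g v.
Proof. by rewrite -{1}[u]scale1r glin scale1r. Qed.

Lemma lin_sgl i (b : bool) c d : g ((-1) ^+ b *: e i) - comb s l c d =
  comb s l ((-1) ^+ b * x i - c) ((-1) ^+ b * y i - d).
Proof. by rewrite linZ ge combZ comb_sub. Qed.

Lemma lin_two i (b : bool) c d : g ((-1) ^+ b *: (2 *: e i)) - comb s l c d =
  comb s l ((-1) ^+ b * (2 * x i) - c) ((-1) ^+ b * (2 * y i) - d).
Proof. by rewrite !linZ ge !combZ comb_sub. Qed.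

Lemma lin_dbl i j (b b' : bool) c d :
  g ((-1) ^+ b *: (e i + (-1) ^+ b' *: e j)) - comb s l c d =
  comb s l ((-1) ^+ b * (x i + (-1) ^+ b' * x j) - c)
    ((-1) ^+ b * (y i + (-1) ^+ b' * y j) - d).
Proof. by rewrite linZ linD linZ !ge !combZ combD !combZ comb_sub. Qed.

End LinearCombination.

(** For more than two coordinates [g] takes the value [s] on the whole orthogonal
    basis. For two coordinates [L] need not be a group, and [g] must send a long
    root to [l]; hence [e i0] goes to [s] and [e i1] to [l - s]. *)
Lemma adapted_BC : B_model I `<=` M -> M `<=` BC_model I ->
  stab S (2 *: s) -> (long_roots f D !=set0 -> stab L (2 *: l)) ->
  (extra_long_roots f D !=set0 -> stab E (4 *: s)) ->
  (forall i j : I, i != j -> [/\ stab L (2 *: s), stab S l,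
     extra_long_roots f D !=set0 -> stab E (2 *: l)
     & card_atleast 3 I -> stab L l]) ->
  exists g, adapted f D S L E s l g.
Proof.
move=> BM MBC S2 L2 E4 cond.
have Mf : M `<=` @finsupp I by move=> u /MBC /BC_finsupp.
have z0 A : stab A (0 *: l) by rewrite scale0r; apply: stab0.
have [[i0 [i1 [i01 n3]]]|no] :=
    pselect (exists i0 i1 : I, i0 != i1 /\ ~ card_atleast 3 I); last first.
  have [g [glin ge]] := linear_ext_const s Mf.
  have {}ge i : g (e i) = comb s l 1 0 by rewrite -comb_s.
  exists g; split=> // a.
  - case/(short_sgl BM MBC) => i [b ->].
    rewrite [X in _ - X](comb_s s l) (lin_sgl glin ge).
    by case: b; [apply: (stab_comb (m := -1) (n := 0) S2 (z0 S))
      | apply: (stab_comb (m := 0) (n := 0) S2 (z0 S))].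
  - case/(BC_long_dbl BM MBC) => i [j [b [c [ij ->]]]].
    have [Ls _ _ Ll] := cond _ _ ij.
    have {}Ll : stab L (1 *: l).
      by rewrite scale1r; apply: Ll; apply: contrapT => n3; apply: no; exists i, j.
    rewrite [X in _ - X](comb_l s l) (lin_dbl glin ge).
    case: b; case: c.
    + by apply: (stab_comb (m := 0) (n := -1) Ls Ll).
    + by apply: (stab_comb (m := -1) (n := -1) Ls Ll).
    + by apply: (stab_comb (m := 0) (n := -1) Ls Ll).
    + by apply: (stab_comb (m := 1) (n := -1) Ls Ll).
  - move=> xa; have hE : extra_long_roots f D !=set0 by exists a.
    case/(extra_two BM MBC) : xa => i [b ->].
    rewrite (comb_cs s l) (lin_two glin ge).
    by case: b; [apply: (stab_comb (m := -1) (n := 0) (E4 hE) (z0 E))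
      | apply: (stab_comb (m := 0) (n := 0) (E4 hE) (z0 E))].
have [Ls Sl El _] := cond _ _ i01.
have {}Sl : stab S (1 *: l) by rewrite scale1r.
have {}L2 : stab L (2 *: l).
  apply: L2; exists (e i0 + (-1) ^+ false *: e i1); apply: dbl_BC_long => //.
  by exists i0, i1, false, false; rewrite [RHS]scale1r.
have [g [glin ge]] := linear_ext_point s (l - s) i1 Mf.
pose x i : rat := if i == i1 then -1 else 1.
pose y i : rat := if i == i1 then 1 else 0.
have {}ge i : g (e i) = comb s l (x i) (y i).
  rewrite ge /x /y; case: eqP => _; last by rewrite -comb_s.
  by rewrite /comb scale1r scaleN1r addrC.
have [x0 y0] : x i0 = 1 /\ y i0 = 0 by rewrite /x /y (negbTE i01).
have [x1 y1] : x i1 = -1 /\ y i1 = 1 by rewrite /x /y eqxx.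
exists g; split=> // a.
- case/(short_sgl BM MBC) => i [b ->].
  rewrite [X in _ - X](comb_s s l) (lin_sgl glin ge).
  case: (two_element i i01 n3) => ->; rewrite ?x0 ?y0 ?x1 ?y1; case: b.
  + by apply: (stab_comb (m := -1) (n := 0) S2 Sl).
  + by apply: (stab_comb (m := 0) (n := 0) S2 Sl).
  + by apply: (stab_comb (m := 0) (n := -1) S2 Sl).
  + by apply: (stab_comb (m := -1) (n := 1) S2 Sl).
- case/(BC_long_dbl BM MBC) => i [j [b [c [ij ->]]]].
  rewrite [X in _ - X](comb_l s l) (lin_dbl glin ge).
  case: (two_element i i01 n3) ij => -> ; case: (two_element j i01 n3) => -> ij.
  + by rewrite eqxx in ij.
  + rewrite x0 y0 x1 y1; case: b; case: c.
    * by apply: (stab_comb (m := -1) (n := 0) Ls L2).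
    * by apply: (stab_comb (m := 0) (n := -1) Ls L2).
    * by apply: (stab_comb (m := 1) (n := -1) Ls L2).
    * by apply: (stab_comb (m := 0) (n := 0) Ls L2).
  + rewrite x0 y0 x1 y1; case: b; case: c.
    * by apply: (stab_comb (m := 1) (n := -1) Ls L2).
    * by apply: (stab_comb (m := 0) (n := -1) Ls L2).
    * by apply: (stab_comb (m := -1) (n := 0) Ls L2).
    * by apply: (stab_comb (m := 0) (n := 0) Ls L2).
  + by rewrite eqxx in ij.
- move=> xa; have hE : extra_long_roots f D !=set0 by exists a.
  have {}E4 := E4 hE; have {}El := El hE.
  case/(extra_two BM MBC) : xa => i [b ->].
  rewrite (comb_cs s l) (lin_two glin ge).
  case: (two_element i i01 n3) => ->; rewrite ?x0 ?y0 ?x1 ?y1; case: b.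
  + by apply: (stab_comb (m := -1) (n := 0) E4 El).
  + by apply: (stab_comb (m := 0) (n := 0) E4 El).
  + by apply: (stab_comb (m := 0) (n := -1) E4 El).
  + by apply: (stab_comb (m := -1) (n := 1) E4 El).
Qed.


Section CTypes.
Hypothesis CM : C_model I `<=` M.
Hypothesis MC : M `<=` C_model I.
Variables i0 i1 : I.
Hypothesis i01 : i0 != i1.

Lemma C_cases a : D a -> dbl a \/ two a.
Proof. by move/(coord_root hP)/MC/coord_C. Qed.

Lemma C_root a : dbl a \/ two a -> D a.
Proof. by move=> k; apply/(coord_root hP)/CM/coord_C. Qed.

Lemma dbl_exists : exists a, dbl a.
Proof.
exists ((-1) ^+ false *: (e i0 + (-1) ^+ false *: e i1)).
by exists i0, i1, false, false.
Qed.

Lemma C_sq_gt0 : 0 < f (e i0) (e i0).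
Proof.
have [a da] := dbl_exists.
by apply: (root_basis_sq_gt0 (a := a)); [apply: C_root; left | right; left].
Qed.

Lemma C_short_dbl a : short_roots f D a -> dbl a.
Proof.
case=> Da amin; have [//|ta] := C_cases Da; have [b db] := dbl_exists.
have := amin b (C_root (or_introl db)); have := C_sq_gt0.
by rewrite (two_sq i0 ta) (dbl_sq i0 db); lra.
Qed.

Lemma dbl_short a : dbl a -> short_roots f D a.
Proof.
move=> da; split=> [|b /C_cases k]; first by apply: C_root; left.
have := C_sq_gt0; rewrite (dbl_sq i0 da).
by case: k => [/(dbl_sq i0)|/(two_sq i0)] ->; lra.
Qed.

Lemma C_extra a : ~ extra_long_roots f D a.
Proof.
case=> Da [b /C_short_dbl db ab]; have := C_sq_gt0.
have : f a a = 8 * f (e i0) (e i0) by rewrite ab !formE (dbl_sq i0 db); ring.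
by case: (C_cases Da) => [/(dbl_sq i0)|/(two_sq i0)] ->; lra.
Qed.

Lemma C_long_two a : long_roots f D a -> two a.
Proof.
by case=> /C_cases[/dbl_short sa|//] nsx; case: nsx; left.
Qed.

Lemma two_C_long a : two a -> long_roots f D a.
Proof.
move=> ta; split=> [|[/C_short_dbl da|/C_extra //]]; first by apply: C_root; right.
by have := C_sq_gt0; have := dbl_sq i0 da; rewrite (two_sq i0 ta); lra.
Qed.

(** Here [g] sends every long root [2 e i] to [l] when there are more than two
    coordinates. With two coordinates [S] need not be a group, and [g] must send
    the short root [e i0 + e i1] to [s]: hence [e i0] goes to [l / 2] and [e i1]
    to [s - l / 2]. *)
Lemma adapted_C : stab S (2 *: s) ->
  (long_roots f D !=set0 -> [/\ stab L (2 *: l), stab L (2 *: s) & stab S l]) ->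
  (card_atleast 3 I -> stab S s) ->
  exists g, adapted f D S L E s l g.
Proof.
move=> S2 cond Ss.
have Mf : M `<=` @finsupp I by move=> u /MC Cu; apply: BC_finsupp; right.
have [|L2 Ls Sl] := cond.
  by exists (2 *: e i0); apply: two_C_long; exists i0, false; rewrite scale1r.
have {}Sl : stab S (1 *: l) by rewrite scale1r.
have [c3|n3] := pselect (card_atleast 3 I).
  have {}Ss : stab S (1 *: s) by rewrite scale1r; apply: Ss.
  have [g [glin ge]] := linear_ext_const (2^-1 *: l) Mf.
  have {}ge i : g (e i) = comb s l 0 2^-1 by rewrite /comb scale0r add0r.
  exists g; split=> // a.
  - case/C_short_dbl => i [j [b [c [ij ->]]]].
    rewrite [X in _ - X](comb_s s l) (lin_dbl glin ge); case: b; case: c.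
    + by apply: (stab_comb (m := -1) (n := 0) Ss Sl).
    + by apply: (stab_comb (m := -1) (n := -1) Ss Sl).
    + by apply: (stab_comb (m := -1) (n := 0) Ss Sl).
    + by apply: (stab_comb (m := -1) (n := 1) Ss Sl).
  - case/C_long_two => i [b ->].
    rewrite [X in _ - X](comb_l s l) (lin_two glin ge); case: b.
    + by apply: (stab_comb (m := 0) (n := -1) Ls L2).
    + by apply: (stab_comb (m := 0) (n := 0) Ls L2).
  - by move=> /C_extra.
have [g [glin ge]] := linear_ext_point (2^-1 *: l) (s - 2^-1 *: l) i1 Mf.
pose x i : rat := if i == i1 then 1 else 0.
pose y i : rat := if i == i1 then - 2^-1 else 2^-1.
have {}ge i : g (e i) = comb s l (x i) (y i).
  rewrite ge /x /y /comb; case: eqP => _; first by rewrite scale1r scaleNr.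
  by rewrite scale0r add0r.
have [x0 y0] : x i0 = 0 /\ y i0 = 2^-1 by rewrite /x /y (negbTE i01).
have [x1 y1] : x i1 = 1 /\ y i1 = - 2^-1 by rewrite /x /y eqxx.
exists g; split=> // a; last by move=> /C_extra.
- case/C_short_dbl => i [j [b [c [ij ->]]]].
  rewrite [X in _ - X](comb_s s l) (lin_dbl glin ge).
  case: (two_element i i01 n3) ij => -> ; case: (two_element j i01 n3) => -> ij.
  + by rewrite eqxx in ij.
  + rewrite x0 y0 x1 y1; case: b; case: c.
    * by apply: (stab_comb (m := 0) (n := -1) S2 Sl).
    * by apply: (stab_comb (m := -1) (n := 0) S2 Sl).
    * by apply: (stab_comb (m := -1) (n := 1) S2 Sl).
    * by apply: (stab_comb (m := 0) (n := 0) S2 Sl).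
  + rewrite x0 y0 x1 y1; case: b; case: c.
    * by apply: (stab_comb (m := -1) (n := 1) S2 Sl).
    * by apply: (stab_comb (m := -1) (n := 0) S2 Sl).
    * by apply: (stab_comb (m := 0) (n := -1) S2 Sl).
    * by apply: (stab_comb (m := 0) (n := 0) S2 Sl).
  + by rewrite eqxx in ij.
- case/C_long_two => i [b ->].
  rewrite [X in _ - X](comb_l s l) (lin_two glin ge).
  case: (two_element i i01 n3) => ->; rewrite ?x0 ?y0 ?x1 ?y1; case: b.
  + by apply: (stab_comb (m := 0) (n := -1) Ls L2).
  + by apply: (stab_comb (m := 0) (n := 0) Ls L2).
  + by apply: (stab_comb (m := -1) (n := 0) Ls L2).
  + by apply: (stab_comb (m := 1) (n := -1) Ls L2).
Qed.

End CTypes.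
End ClassicalTypes.

(** * Adapted maps for every type *)

Section AdaptedMaps.
Variables (V : lmodType rat) (f : {symmetric V}) (D : set V).
Variables (W : lmodType rat) (S L E : set W) (s l : W).
Hypotheses (HD : is_LEARS f D) (Ss : S s).
Hypotheses (rS : reflection_space S) (pS : pointed S).
Hypothesis Ll : long_roots f D !=set0 -> L l.
Hypothesis hL :
  long_roots f D !=set0 -> [/\ L !=set0, L `<=` S, reflection_space L & pointed L].

(** If the sets are stable under [s] and [l], no shear is needed. *)
Lemma adapted_zero : stab S s ->
  (long_roots f D !=set0 -> stab L l) -> extra_long_roots f D = set0 ->
  adapted f D S L E s l (fun=> 0).
Proof.
move=> stS stL noE; split=> [c x y|a _|a la|a].
- by rewrite scaler0 addr0.
- by rewrite sub0r; apply: stabN.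
- by rewrite sub0r; apply: stabN; apply: stL; exists a.
- by rewrite noE.
Qed.

Lemma adapted_simply_laced : same_length f D -> S = subgroup_gen S ->
  adapted f D S L E s l (fun=> 0).
Proof.
move=> /(same_length_short HD)[noL noE] SG; apply: adapted_zero => //.
  by apply: stab_subgroup => //; rewrite SG; apply: subgroup_gen_subgroup.
by rewrite noL => -[].
Qed.

Lemma adapted_two_groups : extra_long_roots f D = set0 ->
  S = subgroup_gen S -> is_subgroup L -> adapted f D S L E s l (fun=> 0).
Proof.
move=> noE SG sL; apply: adapted_zero => // [|/Ll]; last exact: stab_subgroup.
by apply: stab_subgroup => //; rewrite SG; apply: subgroup_gen_subgroup.
Qed.

Lemma adapted_A1 : iso_to_model D (A_model 'I_2) ->
  exists g, adapted f D S L E s l g.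
Proof.
move=> /iso_coordinates[h hP].
have [noL noE] : long_roots f D = set0 /\ extra_long_roots f D = set0.
  apply: (same_length_short HD); apply: (simply_laced HD hP) => x /A_sub_D Dx.
  by split; [apply: D_finsupp | apply: D_norm].
exists (fun v => h v ord0 *: s); split=> [c x y|a [Da _]|a|a]; rewrite ?noL ?noE //.
  rewrite (coordP hP) (_ : (_ + _) ord0 = c * h x ord0 + h y ord0) //.
  by rewrite scalerDl scalerA.
have /(coord_root hP)[i [j [ij ->]]] := Da.
have -> : (eps i - eps j) ord0 = eps i ord0 - eps j ord0 :> rat by [].
have [->|->] : eps i ord0 - eps j ord0 = 1 :> rat \/
    eps i ord0 - eps j ord0 = -1 :> rat.
- case: i j ij => [[|[|//]] hi] [[|[|//]] hj] //= ij; [by left|by right].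
- by rewrite scale1r subrr; apply: stab0.
- rewrite scaleN1r -opprD -mulr2n -scaler_nat.
  by apply: stabN; apply: stab_reflection.
Qed.

Lemma adapted_B_or_BC (I : eqType) (M : set (I -> rat^o)) :
  B_model I `<=` M -> M `<=` BC_model I ->
  (forall i x, M x -> M (flip i x)) -> (forall i j x, M x -> M (swap i j x)) ->
  iso_to_model D M ->
  (extra_long_roots f D !=set0 -> set_add (set_scale 4 S) E `<=` E) ->
  (card_atleast 2 I ->
     [/\ set_add (set_scale 2 S) L `<=` L, set_add S L `<=` S,
         extra_long_roots f D !=set0 -> set_add (set_scale 2 L) E `<=` E
       & card_atleast 3 I -> is_subgroup L]) ->
  exists g, adapted f D S L E s l g.
Proof.
move=> BM MBC flipM swapM /iso_coordinates[h hP] SE cond.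
have SN := reflection_spaceN rS pS.
have rM i : M (1 *: eps i) by apply: BM; left; exists i, false.
have DM : D_model I `<=` M by move=> x Dx; apply: BM; right.
have r0 : 1 != 0 :> rat by [].
have [e eP] := basis_exists hP r0 rM.
have orth := basis_orthogonal HD hP r0 rM flipM eP.
have eqlen := basis_same_length HD hP r0 rM DM flipM swapM eP.
apply: (adapted_BC HD hP eP orth eqlen BM MBC).
- exact: stab_reflection.
- by move=> lx; have [_ _ rL pL] := hL lx; apply: stab_reflection => //; apply: Ll.
- by move=> /SE h4; apply: stab_add h4 _ Ss.
move=> i j ij; have c2 : card_atleast 2 I.
  by apply: (uniq_card_atleast (s := [:: i; j])); rewrite /= inE ij.
have lx : long_roots f D !=set0.
  exists ((-1) ^+ false *: (e i + (-1) ^+ false *: e j)).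
  by apply: (dbl_BC_long HD hP eP orth eqlen BM MBC); exists i, j, false, false.
have [_ _ rL pL] := hL lx; have LN := reflection_spaceN rL pL.
have [c1 c1' c1'' c3] := cond c2; split.
- exact: stab_add c1 _ Ss.
- exact: stab_add1 c1' _ (Ll lx).
- by move=> /c1'' h2; apply: stab_add h2 _ (Ll lx).
- by move=> /c3 sL; apply: stab_subgroup sL _ (Ll lx).
Qed.

Lemma adapted_type_C (I : eqType) : card_atleast 2 I ->
  iso_to_model D (C_model I) -> set_add (set_scale 2 S) L `<=` L ->
  set_add S L `<=` S -> (card_atleast 3 I -> S = subgroup_gen S) ->
  exists g, adapted f D S L E s l g.
Proof.
move=> /card_atleast2[i0 [i1 i01]] /iso_coordinates[h hP] c1 c1' c3.
have SN := reflection_spaceN rS pS.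
have rM i : C_model I (2 *: eps i) by right; exists i, false; rewrite scale1r.
have DM : D_model I `<=` C_model I by move=> x Dx; left.
have r0 : 2 != 0 :> rat by [].
have [e eP] := basis_exists hP r0 rM.
have orth := basis_orthogonal HD hP r0 rM (@flip_C I) eP.
have eqlen := basis_same_length HD hP r0 rM DM (@flip_C I) (@swap_C I) eP.
apply: (adapted_C HD hP E eP orth eqlen (@subset_refl _ _) (@subset_refl _ _) i01).
- exact: stab_reflection.
- move=> lx; have [_ _ rL pL] := hL lx; have LN := reflection_spaceN rL pL.
  split; [by apply: stab_reflection => //; apply: Ll | exact: stab_add c1 _ Ss |].
  exact: stab_add1 c1' _ (Ll lx).
- move=> /c3 SG; apply: stab_subgroup => //.
  by rewrite SG; apply: subgroup_gen_subgroup.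
Qed.

Lemma same_length_model (I : eqType) (M : set (I -> rat^o)) :
  iso_to_model D M -> (forall x, M x -> finsupp x /\ dot x x = 2) ->
  same_length f D.
Proof. by move=> /iso_coordinates[h hP]; apply: simply_laced HD hP. Qed.

Lemma no_extra_model (I : eqType) (M : set (I -> rat^o)) :
  iso_to_model D M -> (forall x, M x -> finsupp x) ->
  (forall x y, M x -> M y -> dot y y != 4 * dot x x) ->
  extra_long_roots f D = set0.
Proof. by move=> /iso_coordinates[h hP]; apply: no_extra_long hP. Qed.

Lemma adapted_exists (T : root_type) : has_type D T ->
  type_condition S L E T -> exists g, adapted f D S L E s l g.
Proof.
have simply (I : eqType) (M : set (I -> rat^o)) : iso_to_model D M ->
    (forall x, M x -> finsupp x /\ dot x x = 2) -> S = subgroup_gen S ->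
    exists g, adapted f D S L E s l g.
  move=> iM nM SG; exists (fun=> 0).
  exact: adapted_simply_laced (same_length_model iM nM) SG.
have AD (I : eqType) x : D_model I x -> finsupp x /\ dot x x = 2.
  by move=> Dx; split; [apply: D_finsupp | apply: D_norm].
have E8 x : E8_model x -> finsupp x /\ dot x x = 2.
  by move=> Ex; split; [apply: finsupp_fin | apply: E8_norm].
case: T => [n|I|I|I|I|I|||||] /=.
- case=> n1 iM SG; have [n1e|/eqP n2] := eqVneq n 1%N.
    by apply: adapted_A1; rewrite -n1e.
  by apply: simply iM _ (SG n2) => x /A_sub_D/AD.
- by case=> _ iM; apply: simply iM _ => x /A_sub_D/AD.
- case=> _ iM cond.
  have noE : extra_long_roots f D = set0.
    apply: no_extra_model iM _ _ => [x Bx|x y]; first by apply: BC_finsupp; left.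
    by move=> /B_norm[->|->] /B_norm[->|->].
  apply: (adapted_B_or_BC _ _ (@flip_B I) (@swap_B I) iM) => //.
  + by move=> x Bx; left.
  + by rewrite noE => -[].
  + by move=> /cond[h1 h2 h3]; split=> //; rewrite noE => -[].
- by case=> c2 iM [h1 h2 h3]; apply: adapted_type_C iM h1 h2 h3.
- by case=> _ iM; apply: simply iM _ => x /AD.
- case=> _ iM [h1 h2 cond]; apply: (adapted_B_or_BC _ _ _ _ iM) => //.
  + by move=> x Bx; left.
  + by move=> i x [Bx|Cx]; [left; apply: flip_B | right; apply: flip_C].
  + by move=> i j x [Bx|Cx]; [left; apply: swap_B | right; apply: swap_C].
  + by move=> /cond[].
- by move=> iM; apply: simply iM _ => x [[/E8]].
- by move=> iM; apply: simply iM _ => x [/E8].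
- by move=> iM; apply: simply iM _ => x /E8.
- move=> iM [SG sL _]; exists (fun=> 0); apply: adapted_two_groups => //.
  apply: no_extra_model iM _ _ => [x _|x y]; first exact: finsupp_fin.
  by move=> /F4_norm[->|->] /F4_norm[->|->].
- move=> iM [SG sL _]; exists (fun=> 0); apply: adapted_two_groups => //.
  apply: no_extra_model iM _ _ => [x _|x y]; first exact: finsupp_fin.
  by move=> /G2_norm[->|->] /G2_norm[->|->].
Qed.

End AdaptedMaps.

(** * Isomorphic systems and isomorphic triples *)

Theorem theorem10 :
  (forall (V1 V2 : lmodType rat) (f1 : {symmetric V1}) (f2 : {symmetric V2})
      (R1 V1' S1 L1 E1 : set V1) (R2 V2' S2 L2 E2 : set V2)
      (phi : {linear V1 -> V2}) (zeta psi : V1 -> V2),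
    is_LEARS f1 R1 -> is_LEARS f2 R2 ->
    reflectable_subspace f1 R1 V1' -> reflectable_subspace f2 R2 V2' ->
    associated_triple f1 R1 V1' S1 L1 E1 ->
    associated_triple f2 R2 V2' S2 L2 E2 ->
    root_iso setT R1 setT R2 phi ->
    (forall v, V1' v -> zeta v = proj_along V2' (radical f2) (phi v)) ->
    (forall v, V1' v -> psi v = proj_along (radical f2) V2' (phi v)) ->
    let D1 := Delta_of f1 R1 V1' in
    let D2 := Delta_of f2 R2 V2' in
    root_iso V1' D1 V2' D2 zeta /\
    triples_related (long_roots f1 D1 !=set0) (extra_long_roots f1 D1 !=set0)
      phi S1 L1 E1 S2 L2 E2) /\
  (forall (V1 V2 W1 W2 : lmodType rat) (f1 : {symmetric V1}) (f2 : {symmetric V2})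
      (D1 : set V1) (D2 : set V2) (S1 L1 E1 : set W1) (S2 L2 E2 : set W2)
      (zeta : {linear V1 -> V2}) (phi : {linear W1 -> W2}),
    is_LFIRS f1 D1 -> is_LFIRS f2 D2 ->
    root_iso setT D1 setT D2 zeta ->
    admissible f1 D1 S1 L1 E1 -> admissible f1 D1 S2 L2 E2 ->
    bijective phi ->
    triples_related (long_roots f1 D1 !=set0) (extra_long_roots f1 D1 !=set0)
      phi S1 L1 E1 S2 L2 E2 ->
    exists Phi : {linear (V1 * W1)%type -> (V2 * W2)%type},
      root_iso setT (LEARS_of_triple f1 D1 S1 L1 E1)
        setT (LEARS_of_triple f2 D2 S2 L2 E2) Phi).
Proof.
split.
  move=> V1 V2 f1 f2 R1 V1' S1 L1 E1 R2 V2' S2 L2 E2 phi zeta psi HR1 HR2 HV1 HV2.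
  move=> T1 T2 iso zetaE _ D1 D2; split; first exact: zeta_iso zetaE.
  exact: zeta_triples iso zetaE _ _ _ _ _ _ T1 T2.
move=> V1 V2 W1 W2 f1 f2 D1 D2 S1 L1 E1 S2 L2 E2 zeta phi [HD1 _] [HD2 _] iso _.
move=> [[_ _ rS pS] hL _ [T hT cT]] phi_bij [[s Ss [eS eE]] hl].
have [l Ll eL] : exists2 l, long_roots f1 D1 !=set0 -> L2 l &
    long_roots f1 D1 !=set0 -> phi @` L1 = set_shift L2 l.
  have [/hl[l Ll el]|nL] := pselect (long_roots f1 D1 !=set0); first by exists l.
  by exists 0.
have [g gP] := adapted_exists HD1 Ss rS pS Ll hL hT cT.
by apply: (shear_iso_exists HD1 HD2 iso phi_bij gP).
Qed.
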